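(* Let $m\geq 1$ and $N\geq 25$ be integers. Then, for either consistent choice of sign $\pm$, $$\left|\nu_{m\pm} - \nu_{m\pm}^{\dagger , N}\right| < \left( 2\sqrt{\log N} + \left( 1 + \frac{1}{\sqrt{N}}\right)^{8} \left( \tfrac{4}{9} + \tfrac{23}{30} N^{-1/6}\right) + \frac{\log\log(N) + 9}{\sqrt{\log N}}\right)^{1/2} N^{-1/4}.$$
   Context: Eigenvalue conventions: for a real symmetric kernel $K^*:[0,1]^2\to\mathbb{R}$ with $\int_0^1\int_0^1 K^*(x,y)^2dxdy<\infty$, a number $\lambda$ is an eigenvalue of $K^*$ if there is a measurable $\phi$ with $0<\int_0^1|\phi(x)|^2dx<\infty$ and $\phi(x)=\lambda\int_0^1K^*(x,y)\phi(y)\,dy$ for all $x\in[0,1]$ (eigenvalues are nonzero reals); its index $m(\lambda,K^* )$ is the finite dimension of the space spanned by its eigenfunctions. Let $\lambda^*_{1+}\le\lambda^*_{2+}\le\cdots$ ($k\le p^*$, $p^*\in\mathbb{N}\cup\{0,\infty\}$) list the positive eigenvalues in increasing order, each $\lambda$ repeated $m(\lambda,K^* )$ times, and $\lambda^*_{1-}\ge\lambda^*_{2-}\ge\cdots$ ($k\le q^*$) list the negative eigenvalues in decreasing order, repeated likewise. For $k\in\mathbb{N}$ put $\nu^*_{k+}=1/\lambda^*_{k+}$ if $k\le p^*$ and $\nu^*_{k+}=0$ otherwise; $\nu^*_{k-}=1/\lambda^*_{k-}$ if $k\le q^*$ and $\nu^*_{k-}=0$ otherwise. The superscript of the kernel is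 carried over to $\nu$ (no superscript for $K$). Kernels: $K(x,y)=\tfrac12-\{1/(xy)\}$ for $0<x,y\le1$, $K(x,0)=K(0,x)=0$, with $\{\cdot\}$ the fractional part; for $N\in\mathbb{N}$, $K^{\dagger,N}(x,y)=\tfrac12-\{N^2/(\lceil Nx\rceil\lceil Ny\rceil)\}$ for $0<x,y\le1$ and $0$ if $xy=0$. *)

(* Defs.v *)
From mathcomp Require Import all_boot all_order all_algebra.
From mathcomp Require Import all_classical all_reals all_analysis.

Set Implicit Arguments.
Unset Strict Implicit.
Unset Printing Implicit Defensive.
Import Order.TTheory GRing.Theory Num.Theory.

Local Open Scope classical_set_scope.
Local Open Scope card_scope.
Local Open Scope ring_scope.

(* A kernel on [0,1]^2 is represented by a function R -> R -> R; only its
   values on [0,1]^2 matter below. *)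

Definition unit_interval (R : realType) : set R := `[0, 1]%classic.

(* Measurability is with respect to the Borel sigma-algebra. For a Borel
   kernel nothing is lost with respect to Lebesgue measurability: the
   right-hand side of the eigenvalue equation, hence phi on [0,1], is then
   automatically Borel. The integrability clause states that the integral in
   that equation exists: Rintegral is a total function. *)
Definition eigenfunction (R : realType) (K : R -> R -> R) (lambda : R)
    (phi : R -> R) : Prop :=
  [/\ measurable_fun (@unit_interval R) phi,
      (0 < \int[lebesgue_measure]_(x in @unit_interval R) (`|phi x| ^+ 2)%:E < +oo)%E &
      forall x : R, x \in `[0, 1] ->
        lebesgue_measure.-integrable (@unit_interval R)
          (EFin \o (fun y => K x y * phi y)) /\
        phi x = lambda * \int[lebesgue_measure]_(y in @unit_interval R) (K x y * phi y)].

Definition eigenvalue (R : realType) (K : R -> R -> R) (lambda : R) : Prop :=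
  exists phi : R -> R, eigenfunction K lambda phi.

(* The space spanned by the eigenfunctions, as functions on [0,1], has
   dimension n: it has a basis of n eigenfunctions. Values outside [0,1] are
   irrelevant. *)
Definition has_index (R : realType) (K : R -> R -> R) (lambda : R)
    (n : nat) : Prop :=
  exists phi : 'I_n -> R -> R,
    [/\ forall i, eigenfunction K lambda (phi i),
        forall c : 'I_n -> R,
          (forall x : R, x \in `[0, 1] -> \sum_(i < n) c i * phi i x = 0) ->
          forall i, c i = 0 &
        forall psi : R -> R, eigenfunction K lambda psi ->
          exists c : 'I_n -> R,
            forall x : R, x \in `[0, 1] -> psi x = \sum_(i < n) c i * phi i x].

(* Lengths of lists are elements of {0, 1, ..., oo}, with None for oo; list
   positions start at 1. *)
Definition in_range (p : option nat) (k : nat) : bool :=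
  (0 < k)%N && (if p is Some n then (k <= n)%N else true).

(* lam 1, lam 2, ... (p entries) lists the eigenvalues of K lying in P, each
   repeated as many times as its index, in the order given by r. *)
Definition eigenvalue_list (R : realType) (K : R -> R -> R) (P : set R)
    (r : rel R) (p : option nat) (lam : nat -> R) : Prop :=
  [/\ forall k, in_range p k -> P (lam k) /\ eigenvalue K (lam k),
      forall j k, in_range p j -> in_range p k -> (j <= k)%N ->
        r (lam j) (lam k) &
      forall lambda, P lambda -> eigenvalue K lambda ->
        exists2 n, has_index K lambda n &
          [set k | in_range p k /\ lam k = lambda] #= `I_n].

(* The sign is + for s = true and - for s = false. *)
Definition signed_eigenvalue_list (R : realType) (K : R -> R -> R) (s : bool)
    (p : option nat) (lam : nat -> R) : Prop :=
  if s then eigenvalue_list K [set l | 0 < l] (fun a b => a <= b) p lam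
  else eigenvalue_list K [set l | l < 0] (fun a b => a >= b) p lam.

Definition nu (R : realType) (p : option nat) (lam : nat -> R) (k : nat) : R :=
  if in_range p k then 1 / lam k else 0.

Definition frac_part (R : realType) (x : R) : R := x - (Num.floor x)%:~R.

Definition ker (R : realType) (x y : R) : R :=
  if x * y == 0 then 0 else 1 / 2 - frac_part (1 / (x * y)).

Definition ker_dagger (R : realType) (N : nat) (x y : R) : R :=
  if x * y == 0 then 0
  else 1 / 2 - frac_part (N%:R ^+ 2 /
         ((Num.ceil (N%:R * x))%:~R * (Num.ceil (N%:R * y))%:~R)).

(* Main.v *)
Require Import Defs.
From mathcomp Require Import all_boot all_order all_algebra.
From mathcomp Require Import all_classical all_reals all_analysis.
From mathcomp Require Import measurable_realfun.
From mathcomp Require Import zify lra ring.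

Import Order.TTheory GRing.Theory Num.Theory.
Import numFieldNormedType.Exports.
Local Open Scope classical_set_scope.
Local Open Scope ring_scope.

Set Implicit Arguments.
Unset Strict Implicit.
Unset Printing Implicit Defensive.

(* By the min-max principle, the m-th positive (or negative) reciprocal
   eigenvalues of two bounded symmetric kernels differ by at most the
   Hilbert-Schmidt norm of the difference of the kernels.

   With x' = ceil(Nx)/N, u = 1/(xy), w = 1/(xy') and v = 1/(x'y'), the difference
   of the two kernels at (x, y) is {v} - {u}. Put rho = (2/N)^(1/2). Outside the
   region where x^2 y <= rho^2 or x y^2 <= rho^2, whose area is at most 4 rho,
   this difference is v - u unless some integer separates v from w or w from u.
   At fixed y, each integer separates v from w only for x in an interval of
   length 1/N, and at most 1/(a y) integers matter where x > a = rho / y^(1/2).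
   Together with w - v <= 1/(N x^2 y) (and symmetrically for u - w) this bounds
   the squared norm by (20/3) rho = 9.428... N^(-1/2), and the numerical factor
   of N^(-1/2) in the square of the stated bound always exceeds 9.43. *)

(** * Bounded measurable functions on a probability space *)

(** The spectral theorem is avoided. Functions are bounded, measurable and defined everywhere, and
    are never identified when they agree almost everywhere; eigenvalue equations then hold at every
    point. Nothing is lost: an eigenfunction of a bounded kernel is bounded, and a bounded kernel
    sends a function that is null in mean square to the function 0.

    Write v for a reciprocal eigenvalue. Min-max needs only this: on functions orthogonal to the
    members with v > 0 of a maximal orthonormal family of eigenfunctions with |v| >= t, the
    quadratic form is at most t. Such a family is finite by Bessel's inequality, and if the form
    exceeded t, the kernel with the family subtracted would supply one more eigenfunction. So the
    only existence result required is one eigenfunction with |v| >= t for a symmetric kernel whose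
    form exceeds t somewhere.

    The m-th reciprocal eigenvalue enters only through the assertion that m orthonormal
    eigenfunctions with v >= t exist; passing between this and the lists of eigenvalues is a count
    of multiplicities. Negative eigenvalues are the positive ones of -K. *)

Definition bmeas d (T : measurableType d) (R : realType) (f : T -> R) : Prop :=
  measurable_fun setT f /\ exists M, forall x, `|f x| <= M.

Section BoundedMeasurable.
Context d (T : measurableType d) (R : realType).
Implicit Types f g : T -> R.

Lemma bmeas_cst (c : R) : bmeas (fun _ : T => c).
Proof. by split; [exact: measurable_cst|exists `|c|]. Qed.

Lemma bmeasD f g : bmeas f -> bmeas g -> bmeas (fun x => f x + g x).
Proof.
move=> [mf [M fM]] [mg [N gN]]; split; first exact: measurable_funD.
by exists (M + N) => x; rewrite (le_trans (ler_normD _ _))// lerD.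
Qed.

Lemma bmeasM f g : bmeas f -> bmeas g -> bmeas (fun x => f x * g x).
Proof.
move=> [mf [M fM]] [mg [N gN]]; split; first exact: measurable_funM.
by exists (M * N) => x; rewrite normrM ler_pM.
Qed.

Lemma bmeasZ (c : R) f : bmeas f -> bmeas (fun x => c * f x).
Proof. by move=> bf; apply: bmeasM => //; exact: bmeas_cst. Qed.

Lemma bmeasN f : bmeas f -> bmeas (fun x => - f x).
Proof.
by move=> /(bmeasZ (-1)); under eq_fun do rewrite mulN1r.
Qed.

Lemma bmeasB f g : bmeas f -> bmeas g -> bmeas (fun x => f x - g x).
Proof. by move=> bf /bmeasN; exact: bmeasD. Qed.

Lemma bmeas_sum (I : Type) (s : seq I) (p : pred I) (F : I -> T -> R) :
  (forall i, p i -> bmeas (F i)) -> bmeas (fun x => \sum_(i <- s | p i) F i x).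
Proof.
move=> bF; elim: s => [|i s IH].
  by under eq_fun do rewrite big_nil; exact: bmeas_cst.
case: (boolP (p i)) => pi.
  under eq_fun do rewrite big_cons pi.
  by apply: bmeasD => //; exact: bF.
by under eq_fun do rewrite big_cons (negbTE pi).
Qed.

End BoundedMeasurable.

Lemma bmeas_comp d d' (T : measurableType d) (T' : measurableType d')
    (R : realType) (f : T -> R) (h : T' -> T) :
  bmeas f -> measurable_fun setT h -> bmeas (fun x => f (h x)).
Proof.
move=> [mf [M fM]] mh; split; first exact: measurableT_comp.
by exists M => x.
Qed.

Section Expectation.
Context d (T : measurableType d) (R : realType) (P : probability T R).
Implicit Types f g : T -> R.

Lemma bmeas_integrable f : bmeas f -> P.-integrable setT (EFin \o f).
Proof.
move=> [mf [M fM]]; apply: (@le_integrable _ _ _ P setT measurableT _ (EFin \o cst `|M|)) => //.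
- exact/measurable_EFinP.
- move=> x _ /=; rewrite lee_fin normr_id (le_trans (fM x))//; exact: ler_norm.
- exact: (finite_measure_integrable_cst P).
Qed.

Lemma mean_cst (c : R) : \int[P]_x c = c.
Proof. by rewrite Rintegral_cst// [X in fine X](probability_setT P) mulr1. Qed.

Lemma meanD f g : bmeas f -> bmeas g ->
  \int[P]_x (f x + g x) = \int[P]_x f x + \int[P]_x g x.
Proof. by move=> bf bg; rewrite RintegralD//; exact: bmeas_integrable. Qed.

Lemma meanB f g : bmeas f -> bmeas g ->
  \int[P]_x (f x - g x) = \int[P]_x f x - \int[P]_x g x.
Proof. by move=> bf bg; rewrite RintegralB//; exact: bmeas_integrable. Qed.

Lemma meanZ (c : R) f : bmeas f -> \int[P]_x (c * f x) = c * \int[P]_x f x.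
Proof. by move=> bf; rewrite RintegralZl//; exact: bmeas_integrable. Qed.

Lemma mean_sum (I : Type) (s : seq I) (F : I -> T -> R) :
  (forall i, bmeas (F i)) ->
  \int[P]_x (\sum_(i <- s) F i x) = \sum_(i <- s) \int[P]_y F i y.
Proof.
move=> bF; elim: s => [|i s IH].
  by under eq_Rintegral do rewrite big_nil; rewrite big_nil mean_cst.
under eq_Rintegral do rewrite big_cons.
by rewrite big_cons meanD ?IH//; apply: bmeas_sum.
Qed.

Lemma le_mean f g : bmeas f -> bmeas g -> (forall x, f x <= g x) ->
  \int[P]_x f x <= \int[P]_x g x.
Proof. by move=> bf bg fg; apply: le_Rintegral => //; exact: bmeas_integrable. Qed.

Lemma mean_ge0 f : (forall x, 0 <= f x) -> 0 <= \int[P]_x f x.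
Proof. by move=> f0; exact: Rintegral_ge0. Qed.

Lemma EFin_mean f : bmeas f -> (\int[P]_x f x)%:E = (\int[P]_x (f x)%:E)%E.
Proof.
move=> bf; rewrite /Rintegral fineK//.
exact: (integrable_fin_num measurableT (bmeas_integrable bf)).
Qed.


Lemma bmeas_mean d' (T' : measurableType d') (F : T' -> T -> R) :
  bmeas (fun z : T' * T => F z.1 z.2) -> bmeas (fun x => \int[P]_y F x y).
Proof.
move=> bF; have [mF [M FM]] := bF.
have bFx x : bmeas (F x) by exact: (bmeas_comp bF (pair1_measurable x)).
split; last first.
  exists M => x.
  rewrite (le_trans (le_normr_Rintegral _ (bmeas_integrable (bFx x))))//.
  rewrite -[leRHS]mean_cst; apply: le_mean; last by move=> y; exact: (FM (x, y)).
  - case: (bFx x) => mFx ?; split; first exact: measurableT_comp.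
    by exists M => y; rewrite normr_id; exact: (FM (x, y)).
  - exact: bmeas_cst.
apply: (measurableT_comp (@fine_measurable _ _ measurableT)).
(* Tonelli's theorem gives measurability for nonnegative integrands, so the bound [M] is added first
   and subtracted at the end. *)
have mEF : measurable_fun setT (fun z : T' * T => (F z.1 z.2 + M)%:E).
  by apply/measurable_EFinP; apply: measurable_funD.
have F0 (z : T' * T) : (0 <= (F z.1 z.2 + M)%:E)%E.
  by rewrite lee_fin; have := FM z; rewrite ler_norml => /andP[]; lra.
have := measurable_fun_fubini_tonelli_F (m2 := P) _ mEF F0.
move=> /(emeasurable_funB) /(_ (measurable_cst M%:E)).
congr (measurable_fun _ _); apply/funext => x /=.
rewrite /fubini_F /= -EFin_mean; last by apply: bmeasD => //; exact: bmeas_cst.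
rewrite meanD ?mean_cst//; last exact: bmeas_cst.
by rewrite -EFinB addrK EFin_mean.
Qed.

End Expectation.

Section Fubini.
Context d1 d2 (T1 : measurableType d1) (T2 : measurableType d2) (R : realType).
Context (P1 : probability T1 R) (P2 : probability T2 R).
Implicit Types F : T1 -> T2 -> R.

Lemma bmeas_row F x : bmeas (fun z => F z.1 z.2) -> bmeas (F x).
Proof. by move=> bF; exact: (bmeas_comp bF (pair1_measurable x)). Qed.

Lemma bmeas_col F y : bmeas (fun z => F z.1 z.2) -> bmeas (F ^~ y).
Proof.
move=> bF; exact: (bmeas_comp bF (pair2_measurable y)).
Qed.

Lemma bmeas_tr F : bmeas (fun z : T1 * T2 => F z.1 z.2) ->
  bmeas (fun z : T2 * T1 => F z.2 z.1).
Proof.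
move=> bF; apply: (bmeas_comp (h := fun z : T2 * T1 => (z.2, z.1)) bF).
exact: measurable_fun_pair measurable_snd measurable_fst.
Qed.

Lemma bmeas_fst (f : T1 -> R) : bmeas f -> bmeas (fun z : T1 * T2 => f z.1).
Proof. by move=> bf; exact: (bmeas_comp bf measurable_fst). Qed.

Lemma bmeas_snd (f : T2 -> R) : bmeas f -> bmeas (fun z : T1 * T2 => f z.2).
Proof. by move=> bf; exact: (bmeas_comp bf measurable_snd). Qed.

Lemma mean_swap F : bmeas (fun z => F z.1 z.2) ->
  \int[P1]_x \int[P2]_y F x y = \int[P2]_y \int[P1]_x F x y.
Proof.
move=> bF; congr fine.
transitivity (\int[P1]_x \int[P2]_y (F x y)%:E)%E.
  by apply: eq_integral => x _; rewrite EFin_mean//; exact: bmeas_row.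
transitivity (\int[P2]_y \int[P1]_x (F x y)%:E)%E.
  exact: (Fubini (bmeas_integrable (P1 \x P2)%E bF)).
by apply: eq_integral => x _; rewrite EFin_mean//; exact: bmeas_col.
Qed.

End Fubini.

(** * The semi-inner product of mean squares *)

Section L2.
Context d (T : measurableType d) (R : realType) (P : probability T R).
Implicit Types f g h : T -> R.

Definition ip f g : R := \int[P]_x (f x * g x).

Lemma ipC f g : ip f g = ip g f.
Proof. by apply: eq_Rintegral => x _; rewrite mulrC. Qed.

Lemma ipDl f g h : bmeas f -> bmeas g -> bmeas h ->
  ip (fun x => f x + g x) h = ip f h + ip g h.
Proof.
move=> bf bg bh; rewrite -meanD; [|exact: bmeasM..].
by apply: eq_Rintegral => x _; rewrite mulrDl.
Qed.

Lemma ipBl f g h : bmeas f -> bmeas g -> bmeas h ->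
  ip (fun x => f x - g x) h = ip f h - ip g h.
Proof.
move=> bf bg bh; rewrite -meanB; [|exact: bmeasM..].
by apply: eq_Rintegral => x _; rewrite mulrBl.
Qed.

Lemma ipZl c f h : bmeas f -> bmeas h -> ip (fun x => c * f x) h = c * ip f h.
Proof.
move=> bf bh; rewrite -meanZ; [|exact: bmeasM].
by apply: eq_Rintegral => x _; rewrite mulrA.
Qed.

Lemma sqZ c f : bmeas f -> ip (fun x => c * f x) (fun x => c * f x) = c ^+ 2 * ip f f.
Proof.
move=> bf; have bcf := bmeasZ c bf.
by rewrite ipZl// ipC ipZl// mulrA expr2.
Qed.

Lemma ip_suml (I : Type) (s : seq I) (F : I -> T -> R) h :
  (forall i, bmeas (F i)) -> bmeas h ->
  ip (fun x => \sum_(i <- s) F i x) h = \sum_(i <- s) ip (F i) h.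
Proof.
move=> bF bh; rewrite -mean_sum; last by move=> i; exact: bmeasM.
by apply: eq_Rintegral => x _; rewrite mulr_suml.
Qed.

Lemma ip_ge0 f : 0 <= ip f f.
Proof. by apply: mean_ge0 => x; rewrite -expr2 sqr_ge0. Qed.

Lemma ip_subsq f g a b : bmeas f -> bmeas g ->
  ip (fun x => a * f x - b * g x) (fun x => a * f x - b * g x) =
  a ^+ 2 * ip f f - 2 * a * b * ip f g + b ^+ 2 * ip g g.
Proof.
move=> bf bg; have [baf bbg] := (bmeasZ a bf, bmeasZ b bg).
have bD := bmeasB baf bbg.
rewrite ipBl// !ipZl// [ip f _]ipC [ip g _]ipC !ipBl// !ipZl// (ipC g f).
ring.
Qed.

Lemma cauchy_schwarz f g : bmeas f -> bmeas g ->
  ip f g ^+ 2 <= ip f f * ip g g.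
Proof.
move=> bf bg; have := ip_ge0 f; rewrite le_eqVlt => /predU1P[f0|f0].
  have H t : 0 <= - 2 * t * ip f g + ip g g.
    by have := ip_ge0 (fun x => t * f x - 1 * g x); rewrite ip_subsq// -f0; lra.
  rewrite -f0 mul0r leNgt; apply/negP => fg.
  have fg0 : ip f g != 0 by rewrite -sqrf_eq0 gt_eqF.
  have := H ((ip g g + 1) / (2 * ip f g)).
  have -> : - 2 * ((ip g g + 1) / (2 * ip f g)) * ip f g = - (ip g g + 1).
    by field.
  lra.
have := ip_ge0 (fun x => ip f g * f x - ip f f * g x); rewrite ip_subsq//.
have -> : ip f g ^+ 2 * ip f f - 2 * ip f g * ip f f * ip f g +
   ip f f ^+ 2 * ip g g = ip f f * (ip f f * ip g g - ip f g ^+ 2) by ring.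
by rewrite pmulr_rge0// subr_ge0.
Qed.

End L2.

(** * Integral operators *)

Section BoundedConvergence.
Context d (T : measurableType d) (R : realType) (P : probability T R).

Lemma bmeas_lim (F : nat -> T -> R) (f : T -> R) (C : R) :
  (forall n, bmeas (F n)) -> (forall n x, `|F n x| <= C) ->
  (forall x, F n x @[n --> \oo] --> f x) -> bmeas f.
Proof.
move=> bF FC Ff; split.
  apply: (@measurable_fun_cvg _ _ _ setT F) => [n|x _]; last exact: Ff.
  by case: (bF n).
exists C => x; rewrite -(cvg_lim _ (cvg_norm (Ff x)))//.
apply: limr_le; first by apply: cvgP; exact: (cvg_norm (Ff x)).
by near=> n; exact: FC.
Unshelve. all: by end_near. Qed.

Lemma bounded_convergence (F : nat -> T -> R) (f : T -> R) (C : R) :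
  (forall n, bmeas (F n)) -> (forall n x, `|F n x| <= C) ->
  (forall x, F n x @[n --> \oo] --> f x) ->
  \int[P]_x F n x @[n --> \oo] --> \int[P]_x f x.
Proof.
move=> bF FC Ff; have bf := bmeas_lim bF FC Ff.
have mF n : measurable_fun setT (EFin \o F n).
  by apply/measurable_EFinP; case: (bF n).
have mf : measurable_fun setT (EFin \o f) by apply/measurable_EFinP; case: bf.
have cF : {ae P, forall x, setT x -> (EFin \o F n) x @[n --> \oo] --> (EFin \o f) x}.
  by apply: aeW => x _; apply: cvg_EFin; [exact: nearW|exact: Ff].
have dF : {ae P, forall x, forall n, setT x -> (`|(EFin \o F n) x| <= (EFin \o cst C) x)%E}.
  by apply: aeW => x n _ /=; rewrite lee_fin.
have [_ _] := dominated_convergence measurableT mF mf cF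
  (finite_measure_integrable_cst P C measurableT) dF.
rewrite -EFin_mean// => /fine_cvgP[_]; apply: cvg_trans; apply: near_eq_cvg.
exact: nearW.
Qed.

End BoundedConvergence.

Section Operator.
Context d (T : measurableType d) (R : realType) (P : probability T R).
Implicit Types (f g : T -> R) (K : T -> T -> R).

Local Notation ip := (ip P).

Definition bkernel K := bmeas (fun z : T * T => K z.1 z.2).

Definition op K f : T -> R := fun x => ip (K x) f.

(** The squared Hilbert-Schmidt norm, written through the rows of the kernel because the
    Cauchy-Schwarz and Bessel inequalities are applied row by row and then averaged. *)
Definition hs2 K : R := \int[P]_x ip (K x) (K x).

Lemma bmeas_op_param (F : T -> T -> R) K : bkernel K -> bkernel F ->
  bkernel (fun y x => op K (F y) x).
Proof.
move=> bK bF.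
apply: (@bmeas_mean _ _ _ P _ _ (fun (z : T * T) u => K z.2 u * F z.1 u)).
apply: bmeasM.
  apply: (@bmeas_comp _ _ _ _ _ _ (fun w : T * T * T => (w.1.2, w.2)) bK).
  apply: measurable_fun_pair; last exact: measurable_snd.
  exact: measurableT_comp measurable_snd measurable_fst.
apply: (@bmeas_comp _ _ _ _ _ _ (fun w : T * T * T => (w.1.1, w.2)) bF).
apply: measurable_fun_pair; last exact: measurable_snd.
exact: measurableT_comp measurable_fst measurable_fst.
Qed.

Lemma bmeas_op K f : bkernel K -> bmeas f -> bmeas (op K f).
Proof.
move=> bK bf; apply: bmeas_mean.
by apply: bmeasM => //; exact: bmeas_snd.
Qed.

Lemma bmeas_hs K : bkernel K -> bmeas (fun x => ip (K x) (K x)).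
Proof. by move=> bK; apply: bmeas_mean; exact: bmeasM. Qed.

Lemma opD K f g x : bkernel K -> bmeas f -> bmeas g ->
  op K (fun x => f x + g x) x = op K f x + op K g x.
Proof.
by move=> bK bf bg; rewrite /op ipC ipDl ?(ipC _ (K x))//; exact: bmeas_row.
Qed.

Lemma opZ K c f x : bkernel K -> bmeas f ->
  op K (fun x => c * f x) x = c * op K f x.
Proof.
by move=> bK bf; rewrite /op ipC ipZl ?(ipC _ (K x))//; exact: bmeas_row.
Qed.

Lemma opB K f g x : bkernel K -> bmeas f -> bmeas g ->
  op K (fun x => f x - g x) x = op K f x - op K g x.
Proof.
by move=> bK bf bg; rewrite /op ipC ipBl ?(ipC _ (K x))//; exact: bmeas_row.
Qed.

Lemma op_sum K (I : Type) (s : seq I) (F : I -> T -> R) x :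
  bkernel K -> (forall i, bmeas (F i)) ->
  op K (fun x => \sum_(i <- s) F i x) x = \sum_(i <- s) op K (F i) x.
Proof.
move=> bK bF; rewrite /op ipC ip_suml//; last exact: bmeas_row.
by apply: eq_bigr => i _; rewrite ipC.
Qed.

Lemma op_sa K f g : bkernel K -> (forall x y, K x y = K y x) ->
  bmeas f -> bmeas g -> ip (op K f) g = ip f (op K g).
Proof.
move=> bK sK bf bg.
transitivity (\int[P]_x \int[P]_y (K x y * (f y * g x))).
  apply: eq_Rintegral => x _; rewrite mulrC -meanZ; last first.
    by apply: bmeasM => //; exact: bmeas_row.
  by apply: eq_Rintegral => y _; ring.
rewrite mean_swap; last first.
  apply: bmeasM => //; apply: bmeasM; first exact: bmeas_snd.
  exact: bmeas_fst.
apply: eq_Rintegral => y _; rewrite -meanZ; last first.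
  by apply: bmeasM => //; exact: bmeas_row.
by apply: eq_Rintegral => x _; rewrite sK; ring.
Qed.

Lemma op_sqr_le K f x : bkernel K -> bmeas f ->
  op K f x ^+ 2 <= ip (K x) (K x) * ip f f.
Proof. by move=> bK bf; apply: cauchy_schwarz => //; exact: bmeas_row. Qed.

Lemma op_hs K f : bkernel K -> bmeas f ->
  ip (op K f) (op K f) <= hs2 K * ip f f.
Proof.
move=> bK bf; rewrite mulrC /hs2 -meanZ; last exact: bmeas_hs.
apply: le_mean => [||x].
- by apply: bmeasM; exact: bmeas_op.
- exact/bmeasZ/bmeas_hs.
- by rewrite -expr2 [leRHS]mulrC; exact: op_sqr_le.
Qed.

(** The rows of a bounded kernel have uniformly bounded norms. This turns convergence in mean square
    into uniform convergence after one application of the operator. *)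
Lemma op_bounded K : bkernel K ->
  exists2 M, 0 <= M & forall g, bmeas g -> forall x, op K g x ^+ 2 <= M * ip g g.
Proof.
move=> bK; have [_ [M hM]] := bmeas_hs bK.
exists `|M|; first exact: normr_ge0.
move=> g bg x; apply: (le_trans (op_sqr_le x bK bg)).
apply: ler_wpM2r; first exact: ip_ge0.
by apply: le_trans (ler_norm _) _; apply: le_trans (hM x) (ler_norm _).
Qed.

(** Here [v] is the reciprocal of an eigenvalue in the sense of the theorem, so 0 is a possible
    value. *)
Definition eigen K (v : R) f : Prop :=
  [/\ bmeas f, 0 < ip f f & forall x, op K f x = v * f x].

End Operator.

(** * Powers of the operator T of a symmetric kernel, and its norm *)

Section TopEigenfunction.
Context d (T : measurableType d) (R : realType) (P : probability T R).
Context (K : T -> T -> R) (bK : bkernel K) (sK : forall x y, K x y = K y x).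
Implicit Types f g : T -> R.

Local Notation ip := (ip P).
Local Notation op := (op P K).
Local Notation sq f := (ip f f).
Local Notation bop := (bmeas_op P bK).

Lemma bmeas_iter_op n f : bmeas f -> bmeas (iter n op f).
Proof. by move=> bf; elim: n => //= n; exact: bop. Qed.

Lemma ip_iter_op a b f : bmeas f ->
  ip (iter a op f) (iter b op f) = ip (iter (a + b) op f) f.
Proof.
move=> bf; elim: b a => [|b IH] a; first by rewrite addn0.
rewrite /= -op_sa//; [|exact: bmeas_iter_op..].
by rewrite addnS -addSn -IH.
Qed.

(** The squared norms a_k of T^k f are log-convex: a_(k+1) is the product of T^k f with T^(k+2) f by
    symmetry, and Cauchy-Schwarz applies. Hence the ratios a_(k+1)/a_k never fall below the first
    one. *)
Lemma sq_iter_op_ge s f n : bmeas f -> 0 < s -> 0 < sq f ->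
  s * sq f <= sq (op f) -> s ^+ n * sq f <= sq (iter n op f).
Proof.
move=> bf s0 f0 sf; pose a k := sq (iter k op f).
suff: 0 < a n /\ s * a n <= a n.+1 /\ s ^+ n * sq f <= a n by case=> _ [].
elim: n => [|n [a0 [an an2]]]; first by rewrite /a /= expr0 mul1r.
have a1 : 0 < a n.+1 by apply: lt_le_trans an; exact: mulr_gt0.
split; first exact: a1.
split; last first.
  by apply: le_trans an; rewrite exprS -mulrA ler_pM2l.
have logconvex : a n.+1 ^+ 2 <= a n * a n.+2.
  have -> : a n.+1 = ip (iter n op f) (iter n.+2 op f).
    by rewrite /a !ip_iter_op// addSnnS.
  by apply: cauchy_schwarz; exact: bmeas_iter_op.
rewrite -(ler_pM2l a0); apply: le_trans logconvex.
rewrite mulrCA mulrA expr2; apply: ler_wpM2r; [exact: ltW|exact: an].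
Qed.

Local Notation G n y := (iter n op (K y)).

Lemma kernel_iter n : bkernel (fun y x => G n y x).
Proof. by elim: n => //= n; exact: bmeas_op_param. Qed.

Lemma bmeas_G n y : bmeas (G n y).
Proof. exact/bmeas_iter_op/bmeas_row. Qed.

Lemma iter_op_kernel n f x : bmeas f ->
  iter n.+1 op f x = \int[P]_y (G n y x * f y).
Proof.
move=> bf; elim: n x => [|n IH] x.
  by apply: eq_Rintegral => y _; rewrite sK.
rewrite iterS {1}/op.
transitivity (\int[P]_u \int[P]_y (K x u * G n y u * f y)).
  apply: eq_Rintegral => u _; rewrite IH -meanZ; last first.
    by apply: bmeasM => //; exact: bmeas_col (kernel_iter n).
  by apply: eq_Rintegral => y _; ring.
rewrite mean_swap; last first.
  apply: bmeasM; last exact: bmeas_snd.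
  apply: bmeasM; last exact: bmeas_tr (kernel_iter n).
  by apply: bmeas_fst; exact: bmeas_row.
apply: eq_Rintegral => y _ /=; rewrite mulrC -meanZ; last first.
  by apply: bmeasM; [exact: bmeas_row|exact: bmeas_G].
by apply: eq_Rintegral => u _; ring.
Qed.

(** The squared Hilbert-Schmidt norm of T^(n+1), whose kernel is [G n]. *)
Definition sigma n := \int[P]_y sq (G n y).

Lemma sq_iter_op_le n f : bmeas f -> sq (iter n.+1 op f) <= sigma n * sq f.
Proof.
move=> bf.
have bGc x : bmeas (fun y => G n y x) by exact: bmeas_col (kernel_iter n).
have bG2 : bmeas (fun x => \int[P]_y (G n y x * G n y x)).
  apply: (@bmeas_mean _ _ _ P _ _ (fun x y => G n y x * G n y x)).
  by apply: bmeasM; exact: bmeas_tr (kernel_iter n).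
have -> : sigma n = \int[P]_x \int[P]_y (G n y x * G n y x).
  rewrite mean_swap//.
  by apply: bmeasM; exact: bmeas_tr (kernel_iter n).
rewrite mulrC -meanZ//; apply: le_mean => [||x].
- by apply: bmeasM; exact: bmeas_iter_op.
- exact: bmeasZ.
- rewrite -expr2 iter_op_kernel// [leRHS]mulrC.
  exact: (cauchy_schwarz _ (bGc x) bf).
Qed.

(** These are the Rayleigh quotients of T^2 rather than of T, so their supremum is the squared
    operator norm whatever the sign of the extreme eigenvalue of T. *)
Definition rayleigh : set R :=
  [set s | exists f, [/\ bmeas f, 0 < sq f & s = sq (op f) / sq f]].

Definition opnorm2 := sup rayleigh.
Local Notation r := opnorm2.

Lemma rayleigh_ub : ubound rayleigh (hs2 P K).
Proof.
move=> _ [f [bf f0 ->]]; rewrite ler_pdivrMr//.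
exact: op_hs.
Qed.

Lemma op_le_opnorm2 f : bmeas f -> sq (op f) <= r * sq f.
Proof.
move=> bf; have := ip_ge0 P f; rewrite le_eqVlt => /predU1P[f0|f0].
  by rewrite -f0 mulr0 (le_trans (op_hs P bK bf))// -f0 mulr0.
rewrite -ler_pdivrMr//; apply: ub_le_sup; first by exists (hs2 P K); exact: rayleigh_ub.
by exists f.
Qed.

(** For a single quotient s the bound on s^(n+1) follows from log-convexity and the Hilbert-Schmidt
    bound for T^(n+1). The supremum need not be attained, so it is reached through the (n+1)-st root
    of [sigma n]. *)
Lemma sigma_ge n : rayleigh !=set0 -> 0 < r -> r ^+ n.+1 <= sigma n.
Proof.
move=> S0 r0.
have H s : rayleigh s -> 0 < s -> s ^+ n.+1 <= sigma n.
  move=> [f [bf f0 sE]] s0; rewrite -(ler_pM2r f0).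
  apply: le_trans (sq_iter_op_le n bf); apply: sq_iter_op_ge => //.
  by rewrite sE divfK ?gt_eqF.
have sig0 : 0 <= sigma n by apply: mean_ge0 => y; exact: ip_ge0.
pose w := sigma n `^ (n.+1%:R^-1).
have w0 : 0 <= w by exact: powR_ge0.
have wE : w ^+ n.+1 = sigma n.
  by rewrite -powR_mulrn// -powRrM mulVf ?powRr1// pnatr_eq0.
rewrite -wE lerXn2r ?nnegrE//; first exact: ltW.
apply: ge_sup => // s Ss; have [s0|s0] := ltP 0 s; last exact: (le_trans s0 w0).
by rewrite -(@ler_pXn2r _ n.+1) ?nnegrE ?wE ?(ltW s0)//; exact: H.
Qed.

End TopEigenfunction.

(** * Existence of eigenfunctions *)

Section SchwarzIterates.
Context d (T : measurableType d) (R : realType) (P : probability T R).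
Context (K : T -> T -> R) (bK : bkernel K) (sK : forall x y, K x y = K y x).
Context (f0 : T -> R) (bf0 : bmeas f0) (t : R) (t0 : 0 < t)
  (tf0 : t * ip P f0 f0 < ip P (op P K f0) f0).

Local Notation ip := (ip P).
Local Notation op := (op P K).
Local Notation sq f := (ip f f).
Local Notation G n y := (iter n op (K y)).
Local Notation r := (opnorm2 P K).

Let ff0 : 0 < sq f0.
Proof.
rewrite lt_neqAle ip_ge0 andbT; apply/eqP => /esym f00.
have := cauchy_schwarz P (bmeas_op P bK bf0) bf0.
move: tf0; rewrite f00 !mulr0 => H; rewrite leNgt => /negP; apply.
by rewrite exprn_gt0.
Qed.

Let rayleigh_neq0 : rayleigh P K !=set0.
Proof. by exists (sq (op f0) / sq f0), f0. Qed.

Let sqr_le_opnorm2 : t ^+ 2 <= r.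
Proof.
have tf : t * sq f0 <= ip (op f0) f0 by exact: ltW.
have := cauchy_schwarz P (bmeas_op P bK bf0) bf0.
have : (t * sq f0) ^+ 2 <= ip (op f0) f0 ^+ 2.
  by rewrite ler_pXn2r ?nnegrE//; [exact/ltW/mulr_gt0|apply/ltW/(le_lt_trans _ tf0)/ltW/mulr_gt0].
move=> /le_trans H /H; have := op_le_opnorm2 P bK bf0 => H1 H2.
rewrite -(ler_pM2r (exprn_gt0 2 ff0)) -exprMn.
apply: (le_trans H2); rewrite expr2 mulrA ler_pM2r//.
Qed.

Let r0 : 0 < r. Proof. by apply: lt_le_trans sqr_le_opnorm2; exact: exprn_gt0. Qed.

Let s k y := sq (G k y) / r ^+ k.

Let s_ge0 k y : 0 <= s k y.
Proof. by rewrite /s divr_ge0 ?ip_ge0// exprn_ge0// ltW. Qed.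

Let s_noninc y : nonincreasing_seq (s ^~ y).
Proof.
apply/nonincreasing_seqP => k; rewrite /s exprS invfM mulrA ler_pM2r; last first.
  by rewrite invr_gt0 exprn_gt0.
rewrite ler_pdivrMr// mulrC; apply: op_le_opnorm2 => //.
exact: bmeas_G.
Qed.

Let s_le n y : s n y <= s 0 y.
Proof. exact: (@s_noninc y 0 n (leq0n n)). Qed.

Let s_cvg y : cvgn (s ^~ y).
Proof.
by apply: nonincreasing_is_cvgn => //; exists 0 => _ [k _ <-].
Qed.

Let bs k : bmeas (s k).
Proof.
have -> : s k = fun y => (r ^+ k)^-1 * sq (G k y).
  by apply/funext => y; rewrite /s mulrC.
apply/bmeasZ/bmeas_mean; apply: bmeasM;
  exact: (kernel_iter P bK).
Qed.

(* s k y is nonincreasing in k because r is the square of the operator norm,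
   while its mean over y stays >= r: the Hilbert-Schmidt norm of T^(k+1)
   dominates its operator norm. *)
Lemma iterates_persist : exists y0, 0 < lim (s n y0 @[n --> \oo]).
Proof.
apply: contrapT => /forallNP H.
have s0 y : s n y @[n --> \oo] --> (0 : R).
  have -> : 0 = lim (s n y @[n --> \oo]).
    apply/eqP; rewrite eq_le; apply/andP; split; last by rewrite leNgt; apply/negP/H.
    by apply: limr_ge => //; exact: nearW.
  exact: s_cvg.
have [_ [C sC]] := bs 0.
have sb n y : `|s n y| <= C.
  rewrite ger0_norm//; apply: (le_trans (s_le n y)).
  by rewrite -[leLHS]ger0_norm// sC.
(* If all limits were 0, the means would tend to 0 and eventually drop below [r]. *)
have := @bounded_convergence _ _ _ P _ _ _ bs sb s0; rewrite mean_cst => /cvgr_lt /(_ r r0) [n _ /(_ n (leqnn n))] /=.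
apply/negP; rewrite -leNgt.
have -> : \int[P]_y s n y = sigma P K n / r ^+ n.
  rewrite /sigma mulrC -meanZ; first by apply: eq_Rintegral => y _; rewrite mulrC.
  by apply: bmeas_mean; apply: bmeasM; exact: (kernel_iter P bK).
by rewrite ler_pdivlMr ?exprn_gt0// -exprS sigma_ge.
Qed.

(** The outer application of T is what makes the sequence converge at every point: the functions
    inside are only shown to be Cauchy in mean square. *)
Let v y n : T -> R := fun x => op (fun u => (r ^+ n)^-1 * G n.*2 y u) x.

Let bA y n : bmeas (fun u => (r ^+ n)^-1 * G n.*2 y u).
Proof. by apply: bmeasZ; exact: bmeas_G. Qed.

Let bv y n : bmeas (v y n). Proof. exact: bmeas_op. Qed.

Let sqA y n m : sq (fun u => (r ^+ n)^-1 * G n.*2 y u - (r ^+ m)^-1 * G m.*2 y u) =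
  s n.*2 y - 2 * s (n + m) y + s m.*2 y.
Proof.
rewrite ip_subsq; [|exact: bmeas_G..].
have -> : ip (G n.*2 y) (G m.*2 y) = sq (G (n + m) y).
  by rewrite !ip_iter_op//; [congr (ip (iter _ op _) _); lia|exact: bmeas_row..].
rewrite /s -!addnn !exprD; field.
by rewrite !expf_neq0// gt_eqF.
Qed.

Let sqA1 y n : sq (fun u => (r ^+ n)^-1 * G n.*2 y u) = s n.*2 y.
Proof.
rewrite sqZ; last exact: bmeas_G.
by rewrite /s -addnn exprD exprVn expr2 mulrC invfM.
Qed.

(* The functions T^(2n+1) K_y / r^n converge uniformly, with no compactness
   argument: <T^a K_y, T^b K_y> depends only on a + b, so the squared distances
   of the T^(2n) K_y / r^n are s (2n) y - 2 s (n+m) y + s (2m) y. The limit phi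
   satisfies T (T phi) = r phi. *)
Lemma opnorm2_eigenfunction : exists v phi, eigen P K v phi /\ v ^+ 2 = r.
Proof.
have [y0 l0] := iterates_persist.
set l := lim _ in l0.
have sl : s n y0 @[n --> \oo] --> l by exact: s_cvg.
have [M M0 HM] := op_bounded P bK.
have v_bd n x : `|v y0 n x| <= Num.sqrt (M * s 0 y0).
  rewrite -sqrtr_sqr ler_wsqrtr// (le_trans (HM _ (bA y0 n) x))//.
  by rewrite sqA1 ler_wpM2l// s_le.
have v_cvg x : cvgn (fun n => v y0 n x).
  apply/cauchy_cvgP/cauchy_exP => e e0.
  (* The squared distance combines three values of [s] with weights 1, -2, 1, each close to [l],
     whence the factor 4; [M + 1] replaces [M] since [M] may be 0. *)
  have M1 : 0 < 4 * (M + 1) by lra.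
  have e1 : 0 < e ^+ 2 / (4 * (M + 1)) by rewrite divr_gt0// exprn_gt0.
  move/cvgrPdist_lt: sl => /(_ _ e1) [N _ HN].
  exists (v y0 N x); exists N => //= n Nn; have {}Nn : (N <= n)%N := Nn.
  rewrite /ball/= -[ltRHS]ger0_norm ?ltW// -ltr_sqr ?nnegrE// !real_normK ?num_real//.
  rewrite /v -opB//.
  apply: le_lt_trans (HM _ (bmeasB (bA y0 N) (bA y0 n)) x) _.
  rewrite sqA.
  have := HN N.*2; have := HN (N + n)%N; have := HN n.*2 => /=.
  have h1 : (N <= n.*2)%N by rewrite -addnn (leq_trans Nn)// leq_addr.
  have h2 : (N <= N + n)%N by exact: leq_addr.
  have h3 : (N <= N.*2)%N by rewrite -addnn leq_addr.
  move=> /(_ h1) + /(_ h2) + /(_ h3); rewrite !ltr_norml.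
  set q := e ^+ 2 / _ in e1 *; have -> : e ^+ 2 = q * (4 * (M + 1)).
    by rewrite /q divfK// gt_eqF.
  set X := s n.*2 y0; set Y := s (N + n) y0; set Z := s N.*2 y0.
  move=> /andP[? ?] /andP[? ?] /andP[? ?].
  apply: (@le_lt_trans _ _ (M * (4 * q))); first by apply: ler_wpM2l => //; lra.
  by nra.
pose phi x := lim (v y0 n x @[n --> \oo]).
have v_phi x : v y0 n x @[n --> \oo] --> phi x by exact: v_cvg.
have bphi : bmeas phi := bmeas_lim (bv y0) v_bd v_phi.
have Kx_cvg (w : nat -> T -> R) w' C : (forall n, bmeas (w n)) ->
    (forall n x, `|w n x| <= C) -> (forall x, w n x @[n --> \oo] --> w' x) ->
    forall x, op (w n) x @[n --> \oo] --> op w' x.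
  move=> bw wC ww' x; have [_ [k Hk]] := bmeas_row x bK.
  apply: (@bounded_convergence _ _ _ P _ _ (k * C)).
  - by move=> n; apply: bmeasM => //; exact: bmeas_row.
  - by move=> n u; rewrite normrM ler_pM.
  - by move=> u; apply: cvgM => //; exact: cvg_cst.
have Tv_cvg x : op (v y0 n) x @[n --> \oo] --> op phi x by exact: Kx_cvg.
have Tv_bd n x : `|op (v y0 n) x| <= Num.sqrt (M * (r * s 0 y0)).
  rewrite -sqrtr_sqr ler_wsqrtr// (le_trans (HM _ (bv y0 n) x))//.
  rewrite ler_wpM2l// (le_trans (op_le_opnorm2 P bK (bA y0 n)))//.
  by rewrite sqA1 ler_pM2l// s_le.
have TTv_cvg x : op (op (v y0 n)) x @[n --> \oo] --> op (op phi) x.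
  by apply: Kx_cvg Tv_bd Tv_cvg _ => n; exact: bmeas_op.
(* T^2 maps [v y0 n] to r times [v y0 n.+1], and bounded convergence lets T pass to the limit. *)
have TTphi x : op (op phi) x = r * phi x.
  apply: (@cvg_unique _ (@norm_hausdorff _ R^o) _ _ _ _ (TTv_cvg x)).
  have -> : (fun n => op (op (v y0 n)) x) = (fun n => r * v y0 n.+1 x).
    apply/funext => n; rewrite /v opZ//; last exact: bmeas_G.
    have -> : op (fun u => (r ^+ n)^-1 * G n.*2 y0 u) =
       (fun u => (r ^+ n)^-1 * G n.*2.+1 y0 u).
      by apply/funext => u; rewrite opZ//; exact: bmeas_G.
    have -> : op (fun u => (r ^+ n)^-1 * G n.*2.+1 y0 u) =
       (fun u => (r ^+ n)^-1 * G n.*2.+2 y0 u).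
      by apply/funext => u; rewrite opZ//; exact: bmeas_G.
    rewrite opZ//; last exact: bmeas_G.
    by rewrite exprS invfM mulrA mulrA divff ?mul1r// gt_eqF.
  apply: cvgM; first exact: cvg_cst.
  by have := v_phi x; rewrite -(cvg_shiftS (fun n => v y0 n x)).
(* The limit is not null because the squared norms r s(2n+1) stay above r l; positivity of [l] is
   the outcome of [iterates_persist]. *)
have phi0 : 0 < sq phi.
  have sv n : sq (v y0 n) = r * s n.*2.+1 y0.
    have -> : v y0 n = (fun u => (r ^+ n)^-1 * G n.*2.+1 y0 u).
      by apply/funext => u; rewrite /v opZ//; exact: bmeas_G.
    rewrite sqZ; last exact: bmeas_G.
    rewrite /s; have -> : r ^+ n.*2.+1 = r * r ^+ n * r ^+ n.
      by rewrite -addnn exprS exprD mulrA.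
    by field; rewrite expf_neq0 gt_eqF.
  have H : sq (v y0 n) @[n --> \oo] --> sq phi.
    apply: (@bounded_convergence _ _ _ P _ _ (Num.sqrt (M * s 0 y0) * Num.sqrt (M * s 0 y0))).
    - by move=> n; exact: bmeasM.
    - by move=> n x; rewrite normrM ler_pM.
    - by move=> x; exact: cvgM.
  apply: (@lt_le_trans _ _ (r * l)); first exact: mulr_gt0.
  rewrite -(cvg_lim _ H)//; apply: limr_ge; first by apply: cvgP H.
  apply: nearW => n; rewrite sv ler_pM2l//.
  by apply: nonincreasing_cvgn_ge.
pose w := Num.sqrt r.
have w2 : w ^+ 2 = r by rewrite sqr_sqrtr// ltW.
(* Factor T^2 - r as (T - w)(T + w). Either g = (T + w) phi is an eigenfunction for [w], or it is
   null; then T g = w g vanishes at every point and [phi] itself is an eigenfunction for -w. *)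
pose g x := op phi x + w * phi x.
have bop : bmeas (op phi) by exact: bmeas_op.
have bg : bmeas g by apply: bmeasD => //; exact: bmeasZ.
have gE x : op g x = w * g x.
  rewrite /g opD//; last exact: bmeasZ.
  by rewrite TTphi opZ// -w2; ring.
have := ip_ge0 P g; rewrite le_eqVlt => /predU1P[g0|g0]; last by exists w, g.
exists (- w), phi; split; last by rewrite sqrrN.
split => // x; have := HM _ bg x; rewrite -g0 mulr0 gE => H.
have : (w * g x) ^+ 2 == 0 by rewrite eq_le H sqr_ge0.
by rewrite sqrf_eq0 mulf_eq0 sqrtr_eq0 leNgt r0/= addr_eq0 mulNr => /eqP.
Qed.

(** By Cauchy-Schwarz t^2 is at most the squared operator norm. The construction sees only T^2 and
    leaves the sign of [v] open, which is why the maximal families used with it are defined by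
    |v|. *)
Lemma exists_eigen : exists v phi, eigen P K v phi /\ t <= `|v|.
Proof.
have [v1 [phi [ephi v2]]] := opnorm2_eigenfunction.
have t_ge0 := ltW t0.
exists v1, phi; split=> //; rewrite -(@ler_pXn2r _ 2)// ?nnegrE//.
by rewrite real_normK ?num_real// v2.
Qed.

End SchwarzIterates.

(** * Orthonormal families of eigenfunctions *)

(** Every dimension count below, in min-max and in both comparisons of multiplicities, goes through
    this. *)
Lemma exists_kernel_row (F : fieldType) (m n : nat) (M : 'M[F]_(m, n)) :
  (n < m)%N -> exists2 c : 'rV[F]_m, c != 0 & c *m M = 0.
Proof.
move=> nm; exists (nz_row (kermx M)); last first.
  by apply/sub_kermxP; exact: nz_row_sub.
rewrite nz_row_eq0 kermx_eq0; apply/negP => /eqP rM.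
by have := rank_leq_col M; rewrite rM leqNgt nm.
Qed.

Section Orthonormal.
Context d (T : measurableType d) (R : realType) (P : probability T R).
Implicit Types (f g : T -> R) (phi : nat -> T -> R).

Local Notation ip := (ip P).
Local Notation sq f := (ip f f).

(** Families are indexed by [nat] with a bound, so that truncating, extending and reindexing them
    needs no casts between ordinals. *)
Definition orthonormal n phi : Prop :=
  (forall i, (i < n)%N -> bmeas (phi i)) /\
  (forall i j, (i < n)%N -> (j < n)%N -> ip (phi i) (phi j) = (i == j)%:R).

Definition lincomb n (c : nat -> R) phi : T -> R :=
  fun x => \sum_(i < n) c i * phi i x.

Lemma bmeas_lincomb n c phi : (forall i, (i < n)%N -> bmeas (phi i)) ->
  bmeas (lincomb n c phi).
Proof. by move=> bphi; apply: bmeas_sum => i _; apply/bmeasZ/bphi. Qed.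

Lemma ip_lincombl n c phi f : (forall i, (i < n)%N -> bmeas (phi i)) -> bmeas f ->
  ip (lincomb n c phi) f = \sum_(i < n) c i * ip (phi i) f.
Proof.
move=> bphi bf; rewrite ip_suml//; last by move=> i; apply/bmeasZ/bphi.
by apply: eq_bigr => i _; rewrite ipZl//; exact: bphi.
Qed.

Lemma ip_lincomb_elem n c phi j : orthonormal n phi -> (j < n)%N ->
  ip (lincomb n c phi) (phi j) = c j.
Proof.
move=> [bphi ophi] jn; rewrite ip_lincombl//; last exact: bphi.
rewrite (bigD1 (Ordinal jn))//= ophi// eqxx mulr1 big1 ?addr0// => i ij.
rewrite ophi//; have /negbTE -> : (i : nat) != j by apply: contra ij => /eqP ij; apply/eqP/val_inj.
by rewrite mulr0.
Qed.

Lemma ip_lincomb n b c phi : orthonormal n phi ->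
  ip (lincomb n b phi) (lincomb n c phi) = \sum_(i < n) b i * c i.
Proof.
move=> ophi; have [bphi _] := ophi.
rewrite ip_lincombl//; last exact: bmeas_lincomb.
by apply: eq_bigr => i _; rewrite ipC ip_lincomb_elem.
Qed.

Lemma bessel n phi f : orthonormal n phi -> bmeas f ->
  \sum_(i < n) ip f (phi i) ^+ 2 <= sq f.
Proof.
move=> ophi bf; have [bphi _] := ophi.
pose h := lincomb n (fun i => ip f (phi i)) phi.
have bh : bmeas h by exact: bmeas_lincomb.
have hh : sq h = \sum_(i < n) ip f (phi i) ^+ 2 by exact: ip_lincomb.
have fh : ip f h = sq h.
  rewrite hh ipC ip_lincombl//; apply: eq_bigr => i _.
  by rewrite (ipC _ _ f) expr2.
have := ip_ge0 P (fun x => 1 * f x - 1 * h x).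
by rewrite ip_subsq// fh -hh; lra.
Qed.

End Orthonormal.

Section EigenFamilies.
Context d (T : measurableType d) (R : realType) (P : probability T R).
Implicit Types (f g : T -> R) (K : T -> T -> R) (S : R -> Prop).

Local Notation ip := (ip P).
Local Notation sq f := (ip f f).

Definition eigen_family K S n (v : nat -> R) (phi : nat -> T -> R) : Prop :=
  orthonormal P n phi /\
  forall i, (i < n)%N -> S (v i) /\ forall x, op P K (phi i) x = v i * phi i x.

Definition has_family K S n := exists v phi, eigen_family K S n v phi.

Lemma eigen_family_sel K S S' n v phi (s : seq nat) :
  eigen_family K S n v phi -> uniq s ->
  {in s, forall i, (i < n)%N /\ S' (v i)} ->
  eigen_family K S' (size s) (fun k => v (nth 0 s k)) (fun k => phi (nth 0 s k)).
Proof.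
move=> [[bphi ophi] ephi] us sn.
have H k : (k < size s)%N -> (nth 0 s k < n)%N by move=> /(mem_nth 0)/sn[].
split; first split => [i /H|i j si sj]; first exact: bphi.
  by rewrite ophi ?H// nth_uniq.
move=> i si; split; first by case: (sn _ (mem_nth 0 si)).
by case: (ephi _ (H _ si)).
Qed.

Lemma has_family_le K S m n : (m <= n)%N -> has_family K S n -> has_family K S m.
Proof.
move=> mn [v [phi [[bphi ophi] ephi]]]; exists v, phi; split; first split.
- by move=> i im; apply: bphi; exact: leq_trans mn.
- by move=> i j im jm; apply: ophi; exact: leq_trans mn.
- by move=> i im; apply: ephi; exact: leq_trans mn.
Qed.

Lemma has_family_extend K S n v phi w psi : bkernel K ->
  eigen_family K S n v phi -> eigen P K w psi -> S w ->
  (forall i, (i < n)%N -> ip psi (phi i) = 0) -> has_family K S n.+1.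
Proof.
move=> bK [[bphi ophi] ephi] [bpsi psi0 epsi] Sw psi_ort.
pose c := (Num.sqrt (sq psi))^-1.
have cpsi : c ^+ 2 * sq psi = 1.
  by rewrite exprVn sqr_sqrtr ?ip_ge0// mulVf// gt_eqF.
pose chi x := c * psi x.
have bchi : bmeas chi by exact: bmeasZ.
exists (fun i => if i == n then w else v i), (fun i => if i == n then chi else phi i).
have cases i : (i < n.+1)%N -> i = n \/ ((i == n) = false /\ (i < n)%N).
  rewrite ltnS leq_eqVlt => /predU1P[->|ilt]; [by left|right].
  by rewrite ltn_eqF.
split; first split.
- by move=> i /cases[->|[-> ilt]]; [rewrite eqxx|exact: bphi].
- move=> i j /cases[->|[iE ilt]] /cases[->|[jE jlt]]; rewrite ?eqxx ?iE ?jE.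
  + by rewrite sqZ.
  + rewrite ipZl//; last exact: bphi.
    by rewrite psi_ort// mulr0 eq_sym jE.
  + rewrite ipC ipZl//; last exact: bphi.
    by rewrite psi_ort// mulr0.
  + exact: ophi.
- move=> i /cases[->|[-> ilt]]; [rewrite eqxx|exact: ephi].
  by split=> // x; rewrite opZ// epsi mulrCA.
Qed.

(** The coefficient of the row K_x along phi_i is (T phi_i)(x) = v_i phi_i(x). Bessel's inequality
    for each row, averaged over x, bounds the sum of the v_i^2 by the squared Hilbert-Schmidt
    norm. *)
Lemma eigen_family_size K S t n v phi : bkernel K ->
  (forall x, S x -> t <= `|x|) -> 0 < t -> eigen_family K S n v phi ->
  n%:R * t ^+ 2 <= hs2 P K.
Proof.
move=> bK St t0 [ophi ephi]; have [bphi ip_phi] := ophi.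
have H : \sum_(i < n) v i ^+ 2 <= hs2 P K.
  have -> : \sum_(i < n) v i ^+ 2 =
      \int[P]_x \sum_(i < n) (v i ^+ 2 * (phi i x * phi i x)).
    rewrite mean_sum; last by move=> i; apply/bmeasZ/bmeasM; exact: bphi.
    apply: eq_bigr => i _; rewrite meanZ; last by apply: bmeasM; exact: bphi.
    by have := ip_phi i i (ltn_ord i) (ltn_ord i); rewrite /ip eqxx => ->; rewrite mulr1.
  apply: le_mean; last 1 first.
  - move=> x; apply: le_trans (bessel ophi (bmeas_row x bK)).
    apply: ler_sum => i _; case: (ephi i (ltn_ord i)) => _ E.
    by have := E x; rewrite /op => ->; rewrite exprMn expr2.
  - by apply: bmeas_sum => i _; apply/bmeasZ/bmeasM; exact: bphi.
  - exact: bmeas_hs.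
apply: le_trans H; rewrite mulr_natl -[X in _ *+ X]card_ord -sumr_const.
apply: ler_sum => i _; case: (ephi i (ltn_ord i)) => /St tv _.
by rewrite -[leRHS]real_normK ?num_real// ler_pXn2r ?nnegrE// ltW.
Qed.

Lemma max_family K S t : bkernel K -> (forall x, S x -> t <= `|x|) -> 0 < t ->
  exists n, has_family K S n /\ forall m, has_family K S m -> (m <= n)%N.
Proof.
move=> bK St t0; pose p n := `[< has_family K S n >].
have p0 : exists n, p n.
  exists 0; apply/asboolP; exists (fun=> 0), (fun=> cst 0).
  by split => //; split.
pose B := Num.bound (hs2 P K / t ^+ 2).
have pB n : p n -> (n <= B)%N.
  move=> /asboolP[v [phi fam]]; have := eigen_family_size bK St t0 fam.
  rewrite -ler_pdivlMr ?exprn_gt0// => nB.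
  have h0 : 0 <= hs2 P K / t ^+ 2.
    rewrite divr_ge0 ?exprn_ge0 ?(ltW t0)//; apply: mean_ge0 => x; exact: ip_ge0.
  have := archi_boundP h0; rewrite -/B => /(le_lt_trans nB).
  by rewrite ltr_nat => /ltnW.
have [n /asboolP pn nmax] := ex_maxnP p0 pB.
by exists n; split => // m /asboolP; exact: nmax.
Qed.

End EigenFamilies.

(** * Min-max *)

Section MinMax.
Context d (T : measurableType d) (R : realType) (P : probability T R).
Implicit Types (f g : T -> R) (K : T -> T -> R).

Local Notation ip := (ip P).
Local Notation sq f := (ip f f).
Local Notation op := (op P).

Definition symmetric_kernel K := bkernel K /\ forall x y, K x y = K y x.

Definition deflate K n (v : nat -> R) (phi : nat -> T -> R) x y : R :=
  K x y - \sum_(i < n) v i * phi i x * phi i y.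

Lemma deflate_symmetric K n v phi : symmetric_kernel K ->
  (forall i, (i < n)%N -> bmeas (phi i)) ->
  symmetric_kernel (deflate K n v phi).
Proof.
move=> [bK sK] bphi; split; last first.
  move=> x y; rewrite /deflate sK; congr (_ - _).
  by apply: eq_bigr => i _; rewrite mulrAC.
apply: bmeasB => //; apply: bmeas_sum => i _; apply: bmeasM.
  by apply/bmeasZ/bmeas_fst/bphi.
by apply/bmeas_snd/bphi.
Qed.

Lemma op_deflate K n v phi f x : bkernel K ->
  (forall i, (i < n)%N -> bmeas (phi i)) -> bmeas f ->
  op (deflate K n v phi) f x =
  op K f x - \sum_(i < n) v i * phi i x * ip f (phi i).
Proof.
move=> bK bphi bf; rewrite {1}/op /deflate ipBl//.
- congr (_ - _); rewrite ip_suml//; last by move=> i; apply/bmeasZ/bphi.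
  by apply: eq_bigr => i _; rewrite ipZl ?(ipC _ f)//; exact: bphi.
- exact: bmeas_row.
- by apply: bmeas_sum => i _; apply/bmeasZ/bphi.
Qed.

(** Suppose the form exceeds t at f. Subtracting the family from the kernel does not lower the form
    at f: members with v_i > 0 are orthogonal to f, the others contribute -v_i times a square. So
    the subtracted kernel L has an eigenfunction with |w| >= t. As L kills the family and w is
    nonzero, it is orthogonal to the family, hence an eigenfunction of K as well, against
    maximality. *)
Lemma max_family_rayleigh K t n v phi f :
  symmetric_kernel K -> 0 < t ->
  eigen_family P K (fun x => t <= `|x|) n v phi ->
  (forall m, has_family P K (fun x => t <= `|x|) m -> (m <= n)%N) ->
  bmeas f -> (forall i, (i < n)%N -> 0 < v i -> ip f (phi i) = 0) ->
  ip (op K f) f <= t * sq f.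
Proof.
move=> symK t0 fam nmax bf f_ort; have [bK sK] := symK.
have [[bphi ophi] ephi] := fam; pose L := deflate K n v phi.
have symL : symmetric_kernel L by exact: deflate_symmetric.
have [bL sL] := symL.
rewrite leNgt; apply/negP => Kf.
have Lf : t * sq f < ip (op L f) f.
  apply: (lt_le_trans Kf).
  have -> : op L f = fun x => op K f x - \sum_(i < n) v i * ip f (phi i) * phi i x.
    apply/funext => x; rewrite op_deflate//; congr (_ - _).
    by apply: eq_bigr => i _; rewrite mulrAC.
  have bs : bmeas (fun x => \sum_(i < n) v i * ip f (phi i) * phi i x).
    by apply: bmeas_sum => i _; apply/bmeasZ/bphi.
  rewrite ipBl//; last exact: bmeas_op.
  rewrite lerDl oppr_ge0 ip_suml//; last by move=> i; apply/bmeasZ/bphi.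
  apply: sumr_le0 => i _; rewrite ipZl//; last exact: bphi.
  have [v0|v0] := ltP 0 (v i); first by rewrite f_ort// mulr0 mul0r.
  by rewrite (ipC _ (phi i)) -mulrA -expr2 mulr_le0_ge0// sqr_ge0.
have [w [psi [epsi tw]]] := exists_eigen bL sL bf t0 Lf.
have [bpsi psi0 Epsi] := epsi.
have w0 : w != 0 by rewrite -normr_gt0 (lt_le_trans t0).
have Lphi j x : (j < n)%N -> op L (phi j) x = 0.
  move=> jn; rewrite op_deflate//; last exact: bphi.
  case: (ephi j jn) => _ ->; rewrite (bigD1 (Ordinal jn))//= ophi// eqxx mulr1.
  rewrite big1 ?addr0 ?subrr// => i ij; rewrite ophi//.
  have /negbTE -> : j != i :> nat.
    by apply: contra ij => /eqP ij; apply/eqP/val_inj.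
  by rewrite mulr0.
have psi_ort j : (j < n)%N -> ip psi (phi j) = 0.
  move=> jn; have := op_sa P bL sL bpsi (bphi j jn).
  have -> : ip psi (op L (phi j)) = 0.
    rewrite -[RHS](mean_cst P); apply: eq_Rintegral => x _.
    by rewrite Lphi// mulr0.
  have -> : op L psi = fun x => w * psi x by apply/funext => x; exact: Epsi.
  rewrite ipZl//; last exact: bphi.
  by move/eqP; rewrite mulf_eq0 (negbTE w0) => /eqP.
have eK : eigen P K w psi.
  split => // x; rewrite -Epsi op_deflate// big1 ?subr0// => i _.
  by rewrite psi_ort// mulr0.
by have := nmax _ (has_family_extend bK fam eK tw psi_ort); rewrite ltnn.
Qed.

(** If K' had fewer than m eigenfunctions with v >= t', some nonzero combination f of the m given
    eigenfunctions of K would be orthogonal to all of them. Its form is at least t for K and at most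
    t' for K', relative to its squared norm, while the difference of the kernels accounts for at
    most delta. *)
Lemma minmax_perturbation K K' t t' delta m :
  symmetric_kernel K -> symmetric_kernel K' ->
  0 <= delta -> hs2 P (fun x y => K x y - K' x y) <= delta ^+ 2 ->
  0 < t' -> t' < t - delta ->
  has_family P K (fun x => t <= x) m -> has_family P K' (fun x => t' <= x) m.
Proof.
move=> [bK sK] symK' d0 hsd t'0 t't [mu [psi fam]].
have [bK' sK'] := symK'; have [[bpsi opsi] epsi] := fam.
have [n [[v [phi fam']] nmax]] :=
  @max_family _ _ _ P K' (fun x => t' <= `|x|) t' bK' (fun _ H => H) t'0.
have [[bphi ophi] ephi] := fam'.
pose s := [seq i <- iota 0 n | 0 < v i].
have sP i : i \in s -> (i < n)%N /\ t' <= v i.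
  rewrite mem_filter mem_iota add0n => /and3P[v0 _ iln]; split=> //.
  by case: (ephi i iln) => + _; rewrite gtr0_norm.
have us : uniq s by rewrite filter_uniq// iota_uniq.
have [ms|sm] := leqP m (size s).
  apply: (has_family_le ms); exists (fun k => v (nth 0 s k)), (fun k => phi (nth 0 s k)).
  exact: eigen_family_sel fam' us _.
exfalso.
pose M := \matrix_(k < m, j < size s) ip (psi k) (phi (nth 0%N s j)).
have [c c0 cM] := exists_kernel_row M sm.
(* [lincomb] takes coefficients indexed by [nat]; outside the row they are set to 0. *)
pose ck (k : nat) : R := if insub k is Some i then c 0 i else 0.
have ckE (k : 'I_m) : ck k = c 0 k by rewrite /ck valK.
pose f := lincomb m ck psi.
have bf : bmeas f by exact: bmeas_lincomb.
have f_ort i : (i < n)%N -> 0 < v i -> ip f (phi i) = 0.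
  move=> iln vi.
  have si : i \in s by rewrite mem_filter vi mem_iota.
  have js : (index i s < size s)%N by rewrite index_mem.
  have := congr1 (fun A : 'rV_(size s) => A 0 (Ordinal js)) cM.
  rewrite !mxE => <-; rewrite ip_lincombl//; last exact: bphi.
  by apply: eq_bigr => k _; rewrite mxE /= nth_index// ckE.
have f0 : 0 < sq f.
  have [k ck0] : exists k, c 0 k != 0 by apply/rV0Pn.
  rewrite (ip_lincomb _ _ fam.1) (bigD1 k)//=; apply: ltr_wpDr.
    by apply: sumr_ge0 => i _; rewrite -expr2 sqr_ge0.
  by rewrite ckE -expr2 exprn_even_gt0.
have Kf : t * sq f <= ip (op K f) f.
  have -> : op K f = lincomb m (fun k => ck k * mu k) psi.
    apply/funext => x; rewrite op_sum//; last by move=> i; apply/bmeasZ/bpsi.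
    apply: eq_bigr => k _; rewrite opZ//; last exact: bpsi.
    by case: (epsi k (ltn_ord k)) => _ ->; rewrite mulrA.
  rewrite !(ip_lincomb _ _ fam.1) mulr_sumr; apply: ler_sum => k _.
  case: (epsi k (ltn_ord k)) => tk _.
  by rewrite mulrAC mulrC ler_wpM2l// -expr2 sqr_ge0.
pose D x y := K x y - K' x y.
have bD : bkernel D by exact: bmeasB.
have Df : ip (op D f) f <= delta * sq f.
  have ff : 0 <= delta * sq f by rewrite mulr_ge0// ltW.
  apply: le_trans (ler_norm _) _; rewrite -[leRHS]ger0_norm//.
  rewrite -ler_sqr ?nnegrE// !real_normK ?num_real//.
  apply: le_trans (cauchy_schwarz P (bmeas_op P bD bf) bf) _.
  rewrite exprMn expr2 [sq f ^+ 2]expr2 mulrA ler_pM2r// -expr2.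
  by apply: (le_trans (op_hs P bD bf)); rewrite ler_pM2r.
have K'f := max_family_rayleigh symK' t'0 fam' nmax bf f_ort.
have E : ip (op D f) f = ip (op K f) f - ip (op K' f) f.
  rewrite -ipBl//; [|exact: bmeas_op..].
  congr (ip _ _); apply/funext => x; rewrite /op ipBl//; exact: bmeas_row.
have H : t * sq f <= (delta + t') * sq f.
  rewrite mulrDl; apply: (le_trans Kf).
  by rewrite -[leLHS](subrK (ip (op K' f) f)) -E; exact: lerD.
move: t't; rewrite ltNge lerBlDl; case/negP.
by rewrite -(ler_pM2r f0).
Qed.

End MinMax.

(** * The unit interval *)

Section UnitInterval.
Context (R : realType).
Implicit Types (f g phi : R -> R) (K : R -> R -> R).

(** A probability on the whole line, so that the abstract results apply to functions on [R]; values
    outside [0,1] influence no mean. *)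
Definition unif : probability (measurableTypeR R) R :=
  [the probability _ _ of uniform_prob (@ltr01 R)].

Local Notation ip := (ip unif).
Local Notation sq f := (ip f f).
Local Notation op := (op unif).
Local Notation I01 := (@unit_interval R).
Local Notation leb := (@lebesgue_measure R).

Lemma measurable_unit : measurable (I01 : set (measurableTypeR R)).
Proof. exact: measurable_itv. Qed.

Lemma ge0_integral_unif f : measurable_fun setT f -> (forall x, 0 <= f x) ->
  (\int[unif]_x (f x)%:E = \int[leb]_(x in I01) (f x)%:E)%E.
Proof.
move=> mf f0; rewrite integral_uniform.
- by rewrite subr0 invr1 mul1e.
- exact/measurable_EFinP.
- by move=> x; rewrite lee_fin.
Qed.

Lemma bmeas_integrable_unit f : bmeas f -> leb.-integrable I01 (EFin \o f).
Proof.
move=> [mf [M fM]]; apply: measurable_bounded_integrable.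
- exact: measurable_unit.
- by rewrite /= lebesgue_measure_itv/= lte_fin ltr01 -EFinB ltry.
- exact: measurable_funTS.
- exists M; split; first exact: num_real.
  by move=> x Mx y _; apply: le_trans (ltW Mx).
Qed.

Lemma unit_measure1 : leb I01 = 1%E.
Proof. by rewrite /unit_interval lebesgue_measure_itv/= lte_fin ltr01 oppr0 adde0. Qed.

Lemma mean_unif f : bmeas f ->
  \int[unif]_x f x = \int[leb]_(x in I01) f x.
Proof.
move=> bf; have [mf [M fM]] := bf.
have bM : bmeas (fun _ : R => M) by exact: bmeas_cst.
have H : \int[unif]_x (f x + M) = \int[leb]_(x in I01) (f x + M).
  congr fine; apply: ge0_integral_unif; first exact: measurable_funD.
  by move=> x; have := fM x; rewrite ler_norml => /andP[]; lra.
move: H; rewrite meanD// mean_cst RintegralD//; last 3 first.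
- exact: measurable_unit.
- exact: bmeas_integrable_unit.
- exact: (bmeas_integrable_unit bM).
rewrite Rintegral_cst; last exact: measurable_unit.
by rewrite [X in fine X]unit_measure1 mulr1 => /addIr.
Qed.

Lemma eq_mean_unit f g : bmeas f -> bmeas g ->
  (forall x, x \in `[0, 1] -> f x = g x) -> \int[unif]_x f x = \int[unif]_x g x.
Proof.
move=> bf bg fg; rewrite !mean_unif//; apply: eq_Rintegral => x.
by rewrite inE => /fg.
Qed.

(** A bootstrap: a square integrable function on [0,1] is integrable, so the equation with a bounded
    kernel makes [phi] bounded on [0,1]. *)
Lemma eigenfunction_eigen K lambda phi : bkernel K ->
  eigenfunction K lambda phi -> lambda != 0 /\
  exists psi, eigen unif K lambda^-1 psi /\
    forall x, x \in `[0, 1] -> psi x = phi x.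
Proof.
move=> bK [mphi /andP[phi0 phioo] ephi].
have [_ [M KM]] := bK.
have mI := measurable_unit.
have l0 : lambda != 0.
  apply/eqP => l0; move: phi0; rewrite integral0_eq ?ltxx// => x.
  rewrite /unit_interval/= => /ephi[_ ->].
  by rewrite l0 mul0r normr0 expr0n.
split=> //.
(* Integrability comes from |phi| <= |phi|^2 + 1. *)
have int_phi : leb.-integrable I01 (EFin \o phi).
  apply: (@le_integrable _ _ _ leb I01 mI _ (EFin \o (fun x => `|phi x| ^+ 2 + 1))).
  - exact/measurable_EFinP.
  - move=> x _ /=; rewrite lee_fin [leRHS]ger0_norm ?addr_ge0// ?exprn_ge0//.
    by have := sqr_ge0 (`|phi x| - 1); nra.
  - have -> : EFin \o (fun x => `|phi x| ^+ 2 + 1) =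
        (fun x => (`|phi x| ^+ 2)%:E) \+ (fun x => (cst 1 x)%:E) by [].
    apply: integrableD => //.
    + apply/integrableP; split.
        apply/measurable_EFinP; apply: measurable_funX.
        exact: measurableT_comp.
      rewrite (le_lt_trans _ phioo)//; apply: ge0_le_integral => //.
      * apply: measurableT_comp => //; apply/measurable_EFinP.
        by apply: measurable_funX; exact: measurableT_comp.
      * by apply/measurable_EFinP; apply: measurable_funX; exact: measurableT_comp.
      * by move=> x _; rewrite gee0_abs// lee_fin exprn_ge0.
    + exact: bmeas_integrable_unit (bmeas_cst _ 1).
pose B := \int[leb]_(x in I01) `|phi x|.
have phiB x : x \in `[0, 1] -> `|phi x| <= `|lambda| * (M * B).
  move=> x01; have [intK ->] := ephi x x01.
  rewrite normrM ler_wpM2l//; apply: (le_trans (@le_normr_Rintegral _ _ _ leb I01 (fun y => K x y * phi y) mI intK)).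
  rewrite /B -RintegralZl//; last exact: (integrable_norm int_phi).
  apply: le_Rintegral => //.
  - exact: (integrable_norm intK).
  - exact: (integrableZl mI M (integrable_norm int_phi)).
  - by move=> y _; rewrite normrM ler_wpM2r//; exact: (KM (x, y)).
pose phi0' := phi \_ I01.
have phi0E x : x \in `[0, 1] -> phi0' x = phi x.
  by move=> x01; rewrite /phi0' patchE mem_set.
have bphi0 : bmeas phi0'.
  split; first by apply: ((measurable_restrictT phi mI).1); exact: mphi.
  exists (`|lambda| * (M * B)) => x; rewrite /phi0' patchE.
  case: ifPn => [/set_mem/phiB//|_]; rewrite normr0.
  have : 0 \in `[0, (1 : R)] by rewrite in_itv/= lexx ler01.
  by move=> /phiB H; exact: (le_trans (normr_ge0 _) H).
(* Off [0,1] the function is defined by the right-hand side of the equation, since [eigen] asks for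
   the equation at every real point. *)
pose psi x := lambda * op K phi0' x.
have bop : bmeas (op K phi0') by exact: bmeas_op.
have bpsi : bmeas psi by exact: bmeasZ.
have psiE x : x \in `[0, 1] -> psi x = phi x.
  move=> x01; have [_ ->] := ephi x x01; congr (_ * _).
  rewrite /op /ip mean_unif; last by apply: bmeasM => //; exact: bmeas_row.
  apply: eq_Rintegral => y; rewrite inE => y01; by rewrite phi0E.
exists psi; split => //; split => //.
  rewrite /ip mean_unif; last exact: bmeasM.
  rewrite /Rintegral fine_gt0//.
  have -> : (\int[leb]_(x in I01) (psi x * psi x)%:E =
      \int[leb]_(x in I01) (`|phi x| ^+ 2)%:E)%E.
    apply: eq_integral => x; rewrite inE => /psiE ->.
    by rewrite real_normK ?num_real// expr2.
  by rewrite phi0.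
move=> x; rewrite /psi mulKf//; apply: eq_mean_unit.
- exact: (bmeasM (bmeas_row x bK) bpsi).
- exact: (bmeasM (bmeas_row x bK) bphi0).
- by move=> y y01 /=; rewrite phi0E// -psiE.
Qed.

Lemma eigen_eigenfunction K v psi : bkernel K -> v != 0 ->
  eigen unif K v psi -> eigenfunction K v^-1 psi.
Proof.
move=> bK v0 [bpsi psi0 epsi]; have [mpsi _] := bpsi.
split; first exact: measurable_funTS.
  have -> : (\int[leb]_(x in I01) (`|psi x| ^+ 2)%:E = (sq psi)%:E)%E.
    rewrite /ip EFin_mean; last exact: bmeasM.
    rewrite ge0_integral_unif; last 2 first.
    - by case: (bmeasM bpsi bpsi).
    - by move=> x; rewrite -expr2 sqr_ge0.
    by apply: eq_integral => x _; rewrite real_normK ?num_real// expr2.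
  by rewrite lte_fin psi0 ltry.
move=> x x01; have bKx : bmeas (fun y => K x y * psi y).
  by apply: bmeasM => //; exact: bmeas_row.
split; first exact: bmeas_integrable_unit.
by rewrite -mean_unif//; have := epsi x; rewrite /op /ip => ->; rewrite mulKf.
Qed.

End UnitInterval.

(** * Multiplicities *)

Lemma card_set_seq (A : eqType) (x0 : A) (s : seq A) :
  uniq s -> ([set` s] #= `I_(size s))%card.
Proof.
move=> us; have -> : [set` s] = nth x0 s @` `I_(size s).
  apply/seteqP; split => [x /= xs|_ [i /= si <-]]; last exact: mem_nth.
  by exists (index x s); [rewrite /= index_mem|rewrite nth_index].
apply: inj_card_eq => i j /set_mem/= si /set_mem/= sj /eqP.
by rewrite nth_uniq// => /eqP.
Qed.

Lemma size_le_card (A : eqType) (s : seq A) (B : set A) n :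
  uniq s -> [set` s] `<=` B -> (B #= `I_n)%card -> (size s <= n)%N.
Proof.
case: s => [//|x0 s'] us sB Bn; rewrite -card_le_II.
rewrite -(card_le_eql (card_set_seq x0 us)) -(card_le_eqr Bn).
exact: subset_card_le.
Qed.

Lemma card_le_size (A : eqType) (x0 : A) (s : seq A) (B : set A) n :
  uniq s -> B `<=` [set` s] -> (B #= `I_n)%card -> (n <= size s)%N.
Proof.
move=> us sB Bn; rewrite -card_le_II.
rewrite -(card_le_eqr (card_set_seq x0 us)) -(card_le_eql Bn).
exact: subset_card_le.
Qed.

Lemma size_le_count (A : eqType) (s1 s2 : seq A) :
  (forall x, x \in s1 -> (count_mem x s1 <= count_mem x s2)%N) ->
  (size s1 <= size s2)%N.
Proof.
move=> H; have /count_subseqP[s ss /perm_size ->] :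
    forall x, (count_mem x s1 <= count_mem x s2)%N.
  by move=> x; have [/H//|/count_memPn ->] := boolP (x \in s1).
exact: size_subseq.
Qed.

Section Multiplicity.
Context (R : realType) (K : R -> R -> R) (bK : bkernel K)
  (sK : forall x y, K x y = K y x).

Local Notation P := (@unif R).
Local Notation ip := (ip P).
Local Notation sq f := (ip f f).

Let idx n (v : nat -> R) w := [seq i <- iota 0 n | v i == w].

Let size_idx n (v : nat -> R) w : size (idx n v w) = count_mem w (map v (iota 0 n)).
Proof. by rewrite size_filter count_map; apply: eq_count => i. Qed.

(** The members of the family with value 1/lambda are orthonormal eigenfunctions in a space spanned
    by k functions. With more than k of them, a nontrivial combination would vanish on [0,1],
    although its squared norm is a nonzero sum of squares. *)
Lemma family_count_le S n v phi lambda k : lambda != 0 ->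
  eigen_family P K S n v phi -> has_index K lambda k ->
  (count_mem lambda^-1 (map v (iota 0 n)) <= k)%N.
Proof.
move=> l0 fam [b [_ _ bspan]]; rewrite -size_idx leqNgt; apply/negP => ks.
set s := idx n v lambda^-1 in ks.
have sP i : i \in s -> (i < n)%N /\ v i = lambda^-1.
  by rewrite mem_filter mem_iota => /andP[/eqP -> /andP[]].
have us : uniq s by rewrite filter_uniq// iota_uniq.
have [os es] := eigen_family_sel (S' := fun x => x = lambda^-1) fam us sP.
set psi := (fun k => phi (nth 0 s k)) in os es.
have /choice[M HM] : forall i : 'I_(size s), exists c : 'I_k -> R,
    forall x, x \in `[0, 1] -> psi i x = \sum_(j < k) c j * b j x.
  move=> i; apply: bspan; rewrite -[lambda]invrK.
  case: os => bpsi ipsi; case: (es i (ltn_ord i)) => vi epsi.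
  apply: eigen_eigenfunction => //; first by rewrite invr_eq0.
  split; [exact: bpsi| |by move=> x; rewrite epsi vi].
  by rewrite ipsi// eqxx.
have [c c0 cM] := exists_kernel_row (\matrix_(i < size s, j < k) M i j) ks.
pose ck (i : nat) : R := if insub i is Some j then c 0 j else 0.
have ckE (i : 'I_(size s)) : ck i = c 0 i by rewrite /ck valK.
have bpsi := os.1.
have f0 x : x \in `[0, 1] -> lincomb (size s) ck psi x = 0.
  move=> x01; rewrite /lincomb.
  under eq_bigr => i _ do rewrite (HM i x x01) mulr_sumr.
  rewrite exchange_big/= big1// => j _.
  have E : \sum_(i < size s) c 0 i * M i j = 0.
    have := congr1 (fun A : 'rV_k => A 0 j) cM; rewrite !mxE => E0.
    by rewrite -[RHS]E0; apply: eq_bigr => i _; rewrite mxE.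
  transitivity ((\sum_(i < size s) c 0 i * M i j) * b j x).
    by rewrite mulr_suml; apply: eq_bigr => i _; rewrite ckE mulrA.
  by rewrite E mul0r.
have bf : bmeas (lincomb (size s) ck psi) by exact: bmeas_lincomb.
have [k' ck0] : exists k, c 0 k != 0 by apply/rV0Pn.
have : sq (lincomb (size s) ck psi) = 0.
  rewrite -[RHS](mean_cst P); apply: eq_mean_unit.
  - exact: bmeasM.
  - exact: bmeas_cst.
  - by move=> x x01; rewrite f0// mulr0.
rewrite (ip_lincomb _ _ os) => /eqP; rewrite psumr_eq0; last first.
  by move=> i _; rewrite -expr2 sqr_ge0.
move=> /allP/(_ k' (mem_index_enum _))/=.
by rewrite ckE -expr2 sqrf_eq0 (negbTE ck0).
Qed.

(** By maximality every eigenfunction for lambda lies in the span of the members with value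
    1/lambda: it is orthogonal to the other members, and its remainder after projection is 0 or
    would extend the family. With too few such members the k independent basis functions could not
    fit. *)
Lemma family_count_ge S n v phi lambda k : lambda != 0 -> S lambda^-1 ->
  eigen_family P K S n v phi -> (forall m, has_family P K S m -> (m <= n)%N) ->
  has_index K lambda k ->
  (k <= count_mem lambda^-1 (map v (iota 0 n)))%N.
Proof.
move=> l0 Sl fam nmax [b [eb bfree _]].
rewrite -size_idx leqNgt; apply/negP => sk.
set s := idx n v lambda^-1 in sk.
have [ophi ephi] := fam; have [bphi ip_phi] := ophi.
have /choice[M HM] : forall j : 'I_k, exists c : 'I_(size s) -> R,
    forall x, x \in `[0, 1] -> b j x = \sum_(i < size s) c i * phi (nth 0 s i) x.
  move=> j; have [_ [psi [epsi psib]]] := eigenfunction_eigen bK (eb j).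
  have [bpsi psi0 Epsi] := epsi.
  have ort i : (i < n)%N -> v i != lambda^-1 -> ip psi (phi i) = 0.
    move=> iln vi; have := op_sa P bK sK bpsi (bphi i iln).
    have -> : op P K psi = fun x => lambda^-1 * psi x by apply/funext => x.
    have -> : op P K (phi i) = fun x => v i * phi i x.
      by apply/funext => x; case: (ephi i iln).
    have -> : ip psi (fun x => v i * phi i x) = v i * ip psi (phi i).
      by rewrite ipC ipZl ?(ipC _ psi)//; exact: bphi.
    rewrite ipZl//; last exact: bphi.
    by move/eqP; rewrite -subr_eq0 -mulrBl mulf_eq0 subr_eq0 eq_sym (negbTE vi) => /eqP.
  pose h := lincomb n (fun i => ip psi (phi i)) phi.
  have bh : bmeas h by exact: bmeas_lincomb.
  pose chi x := psi x - h x.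
  have bchi : bmeas chi by exact: bmeasB.
  have Echi x : op P K chi x = lambda^-1 * chi x.
    rewrite opB// Epsi mulrBr; congr (_ - _).
    rewrite op_sum//; last by move=> i; apply/bmeasZ/bphi.
    rewrite /h /lincomb mulr_sumr; apply: eq_bigr => i _.
    rewrite opZ//; last exact: bphi.
    have [vi|vi] := eqVneq (v i) lambda^-1; last by rewrite ort// !mul0r mulr0.
    by case: (ephi i (ltn_ord i)) => _ ->; rewrite vi mulrCA.
  (* A remainder that is null in mean square vanishes at every point, because it is a multiple of
     its own image under the operator. *)
  have chi0 x : chi x = 0.
    have := ip_ge0 P chi; rewrite le_eqVlt => /predU1P[chi0|chi0].
      have := op_sqr_le P x bK bchi; rewrite -chi0 mulr0 Echi => H.
      have : (lambda^-1 * chi x) ^+ 2 == 0 by rewrite eq_le H sqr_ge0.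
      by rewrite sqrf_eq0 mulf_eq0 invr_eq0 (negbTE l0) => /eqP.
    have : has_family P K S n.+1.
      apply: (has_family_extend bK fam (psi := chi) (w := lambda^-1)) => //.
      by move=> i iln; rewrite ipBl ?ip_lincomb_elem ?subrr//; exact: bphi.
    by move=> /nmax; rewrite ltnn.
  exists (fun i => ip psi (phi (nth 0 s i))) => x x01.
  rewrite -psib//; have /eqP := chi0 x; rewrite subr_eq0 => /eqP ->.
  rewrite -(big_mkord xpredT (fun i => ip psi (phi (nth 0%N s i)) * phi (nth 0%N s i) x)).
  rewrite -(big_nth 0 xpredT (fun i => ip psi (phi i) * phi i x)).
  rewrite big_filter /h /lincomb -(big_mkord xpredT (fun i => ip psi (phi i) * phi i x)).
  rewrite /index_iota subn0 [RHS]big_mkcond/= big_seq [RHS]big_seq.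
  apply: eq_bigr => i; rewrite mem_iota add0n /= => iln.
  by case: ifPn => // vi; rewrite ort// mul0r.
have [c c0 cM] := exists_kernel_row (\matrix_(j < k, i < size s) M j i) sk.
have [k' ck0] : exists k, c 0 k != 0 by apply/rV0Pn.
suff : c 0 k' = 0 by apply/eqP.
apply: (bfree (fun j => c 0 j)) => x x01.
under eq_bigr => j _ do rewrite (HM j x x01) mulr_sumr.
rewrite exchange_big/= big1// => i _.
have E : \sum_(j < k) c 0 j * M j i = 0.
  have := congr1 (fun A : 'rV_(size s) => A 0 i) cM; rewrite !mxE => E0.
  by rewrite -[RHS]E0; apply: eq_bigr => j _; rewrite mxE.
transitivity ((\sum_(j < k) c 0 j * M j i) * phi (nth 0%N s i) x).
  by rewrite mulr_suml; apply: eq_bigr => j _; rewrite mulrA.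
by rewrite E mul0r.
Qed.

End Multiplicity.

(** * From lists of eigenvalues to families of eigenfunctions *)

Section EigenvalueLists.
Context (R : realType).
Implicit Types (K : R -> R -> R) (lam : nat -> R) (p : option nat).

Local Notation P := (@unif R).
Local Notation pos_list K := (eigenvalue_list K [set l | 0 < l] (fun a b => a <= b)).

Lemma in_range_le p j k : (0 < j)%N -> (j <= k)%N -> in_range p k -> in_range p j.
Proof.
rewrite /in_range => j0 jk /andP[_]; rewrite j0 /=.
by case: p => // n; exact: leq_trans.
Qed.

Lemma nu_ge0 K p lam k : pos_list K p lam -> 0 <= nu p lam k.
Proof.
move=> [lam0 _ _]; rewrite /nu; case: ifPn => // /lam0[/= l0 _].
by rewrite div1r invr_ge0 ltW.
Qed.

(** The reciprocals of the first m list entries are all at least t. Each occurs among them at most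
    as often as its index, hence at most as often as in a maximal family, so that family has at
    least m members. *)
Lemma nu_has_family K p lam t m : symmetric_kernel K -> pos_list K p lam ->
  0 < t -> t <= nu p lam m -> has_family P K (fun x => t <= x) m.
Proof.
move=> [bK sK] [lam0 lam_mono lam_idx] t0 tm.
(* As t > 0, the value of [nu] is not the padding 0. *)
have rm : in_range p m.
  by move: tm; rewrite /nu; case: ifPn => // _; rewrite leNgt t0.
have m0 : (0 < m)%N by case/andP: rm.
have [n [fam nmax]] := max_family P (S := fun x => t <= x) bK
  (fun x H => le_trans H (ler_norm x)) t0.
apply: (has_family_le _ fam); have [v [phi efam]] := fam.
pose L := map (fun k => (lam k)^-1) (iota 1 m).
have -> : m = size L by rewrite size_map size_iota.
rewrite -[n](size_iota 0) -(size_map v); apply: size_le_count => x.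
move=> /mapP[k]; rewrite mem_iota add1n ltnS => /andP[k0 km] ->{x}.
have rk : in_range p k by exact: in_range_le rm.
have [/= l0 el] := lam0 k rk.
have [c idx card_idx] := lam_idx _ l0 el.
have tl : t <= (lam k)^-1.
  apply: (le_trans tm); rewrite /nu rm div1r lef_pV2 ?posrE//; first exact: lam_mono.
  by case: (lam0 m rm).
apply: leq_trans (family_count_ge bK sK (lt0r_neq0 l0) tl efam nmax idx).
have -> : count_mem (lam k)^-1 L = size [seq j <- iota 1 m | lam j == lam k].
  rewrite count_map size_filter; apply: eq_count => j /=.
  by apply/eqP/eqP => [/invr_inj|->].
apply: size_le_card card_idx; first by rewrite filter_uniq// iota_uniq.
move=> j /=; rewrite mem_filter mem_iota add1n ltnS => /and3P[/eqP jk j0 jm].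
by split => //; exact: in_range_le rm.
Qed.

(** Otherwise every list position holding an eigenvalue of the family would come before position m,
    since the list is increasing. Counting with multiplicity, m members would fit into m - 1
    positions. *)
Lemma has_family_nu K p lam t m : symmetric_kernel K -> pos_list K p lam ->
  (0 < m)%N -> 0 < t -> has_family P K (fun x => t <= x) m -> t <= nu p lam m.
Proof.
move=> [bK sK] [lam0 lam_mono lam_idx] m0 t0 [v [phi fam]].
rewrite leNgt; apply/negP => num.
pose L := map (fun k => (lam k)^-1) (iota 1 m.-1).
suff : (size (map v (iota 0 m)) <= size L)%N.
  by rewrite !size_map !size_iota leqNgt prednK// leqnn.
apply: size_le_count => x /mapP[i]; rewrite mem_iota add0n /= => im ->{x}.
have [[bphi ip_phi] ephi] := fam.
have [tv Ev] := ephi i im.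
have v0 : 0 < v i by exact: lt_le_trans tv.
have l0 : 0 < (v i)^-1 by rewrite invr_gt0.
have el : Defs.eigenvalue K (v i)^-1.
  exists (phi i); apply: eigen_eigenfunction => //; first exact: lt0r_neq0.
  by split; [exact: bphi|rewrite ip_phi// eqxx|].
have [c idx card_idx] := lam_idx _ l0 el.
have := family_count_le bK (lt0r_neq0 l0) fam idx; rewrite invrK.
move=> /leq_trans; apply.
have -> : count_mem (v i) L = size [seq j <- iota 1 m.-1 | lam j == (v i)^-1].
  rewrite count_map size_filter; apply: eq_count => j /=.
  by apply/eqP/eqP => [<-|->]; rewrite invrK.
apply: card_le_size card_idx => //; first by rewrite filter_uniq// iota_uniq.
move=> k /= [rk lk]; rewrite mem_filter lk eqxx mem_iota add1n prednK//.
case/andP: (rk) => -> _ /=; rewrite ltnNge; apply/negP => mk.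
have rm : in_range p m by exact: in_range_le rk.
move: num; rewrite /nu rm div1r ltNge; case/negP.
apply: (le_trans tv); rewrite -[v i]invrK -lk lef_pV2 ?posrE; first exact: lam_mono.
  by rewrite lk.
by case: (lam0 m rm).
Qed.

Lemma nu_perturbation_le K K' p p' lam lam' m delta :
  symmetric_kernel K -> symmetric_kernel K' ->
  pos_list K p lam -> pos_list K' p' lam' -> (0 < m)%N -> 0 <= delta ->
  hs2 P (fun x y => K x y - K' x y) <= delta ^+ 2 ->
  nu p lam m - delta <= nu p' lam' m.
Proof.
move=> sK sK' lK lK' m0 d0 hsd; rewrite leNgt; apply/negP => H.
have nu0 := nu_ge0 m lK'.
(* A threshold strictly between the two sides; it is positive because [nu p' lam' m] is
   nonnegative. *)
pose t' := (nu p' lam' m + (nu p lam m - delta)) / 2.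
have t'0 : 0 < t' by rewrite /t'; lra.
have tt' : t' < nu p lam m - delta by rewrite /t'; lra.
have num0 : 0 < nu p lam m by lra.
have fam := nu_has_family sK lK num0 (lexx _).
have := has_family_nu sK' lK' m0 t'0
  (minmax_perturbation (P := P) sK sK' d0 hsd t'0 tt' fam).
by rewrite /t'; lra.
Qed.

Lemma hs2_subC K K' :
  hs2 P (fun x y => K x y - K' x y) = hs2 P (fun x y => K' x y - K x y).
Proof.
by apply: eq_Rintegral => x _; apply: eq_Rintegral => y _; ring.
Qed.

Lemma nu_perturbation_pos K K' p p' lam lam' m delta :
  symmetric_kernel K -> symmetric_kernel K' ->
  pos_list K p lam -> pos_list K' p' lam' -> (0 < m)%N -> 0 <= delta ->
  hs2 P (fun x y => K x y - K' x y) <= delta ^+ 2 ->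
  `|nu p lam m - nu p' lam' m| <= delta.
Proof.
move=> sK sK' lK lK' m0 d0 hsd; rewrite ler_norml.
have := nu_perturbation_le sK sK' lK lK' m0 d0 hsd.
have := nu_perturbation_le sK' sK lK' lK m0 d0; rewrite hs2_subC => /(_ hsd).
lra.
Qed.

(** Reduces the negative sign to the positive one: replacing K by -K keeps the eigenfunctions and
    reverses the order of the eigenvalues. *)
Lemma eigenfunction_opp K lambda phi :
  eigenfunction K lambda phi <-> eigenfunction (fun x y => - K x y) (- lambda) phi.
Proof.
have H K' l' : eigenfunction K' l' phi ->
    eigenfunction (fun x y => - K' x y) (- l') phi.
  move=> [mphi phi0 ephi]; split => // x /ephi[iK E].
  have NE : (fun y => - K' x y * phi y) = fun y => -1 * (K' x y * phi y).
    by apply/funext => y; ring.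
  rewrite NE; split.
    exact: (integrableZl (@measurable_unit R) (-1) iK).
  rewrite RintegralZl//; last exact: measurable_unit.
  by rewrite mulN1r mulrNN.
split; first exact: H.
have NK : (fun x y => - - K x y) = K.
  by apply/funext => x; apply/funext => y; rewrite opprK.
by move=> /H; rewrite opprK NK.
Qed.

Lemma eigenvalue_opp K lambda :
  Defs.eigenvalue K lambda <-> Defs.eigenvalue (fun x y => - K x y) (- lambda).
Proof. by split => -[phi ephi]; exists phi; apply/(eigenfunction_opp K). Qed.

Lemma has_index_opp K lambda n :
  has_index K lambda n -> has_index (fun x y => - K x y) (- lambda) n.
Proof.
move=> [phi [ephi free span]]; exists phi; split => //.
  by move=> i; apply/(eigenfunction_opp K).
by move=> psi /(eigenfunction_opp K); exact: span.
Qed.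

Lemma neg_list_opp K p lam :
  eigenvalue_list K [set l | l < 0] (fun a b => a >= b) p lam ->
  pos_list (fun x y => - K x y) p (fun k => - lam k).
Proof.
move=> [lam0 lam_mono lam_idx]; split.
- move=> k /lam0[/= l0 el]; split; first by rewrite /= oppr_gt0.
  exact/(eigenvalue_opp K).
- by move=> j k rj rk jk; rewrite lerN2; exact: lam_mono.
- move=> l /= l0 el.
  have [||n idx cardn] := lam_idx (- l); first by rewrite /= oppr_lt0.
    by apply/(eigenvalue_opp K); rewrite opprK.
  exists n; first by rewrite -[l]opprK; exact: has_index_opp.
  rewrite (_ : [set k | _] = [set k | in_range p k /\ lam k = - l])//.
   apply/seteqP; split => k /= [rk].
    by move=> <-; rewrite opprK.
  by move=> ->; rewrite opprK.
Qed.

Lemma nu_opp p lam k : nu p (fun j => - lam j) k = - nu p lam k.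
Proof. by rewrite /nu; case: ifPn => _; rewrite ?oppr0// invrN mulrN. Qed.

Lemma symmetric_kernel_opp K : symmetric_kernel K ->
  symmetric_kernel (fun x y => - K x y).
Proof.
by move=> [bK sK]; split; [exact: bmeasN|move=> x y; rewrite sK].
Qed.

Lemma nu_perturbation K K' s p p' lam lam' m delta :
  symmetric_kernel K -> symmetric_kernel K' ->
  signed_eigenvalue_list K s p lam -> signed_eigenvalue_list K' s p' lam' ->
  (0 < m)%N -> 0 <= delta ->
  hs2 P (fun x y => K x y - K' x y) <= delta ^+ 2 ->
  `|nu p lam m - nu p' lam' m| <= delta.
Proof.
case: s => sK sK' /= lK lK' m0 d0 hsd; first exact: (nu_perturbation_pos sK sK').
rewrite -normrN opprB.
have -> : nu p' lam' m - nu p lam m =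
    nu p (fun k => - lam k) m - nu p' (fun k => - lam' k) m.
  by rewrite !nu_opp; ring.
apply: (nu_perturbation_pos (symmetric_kernel_opp sK) (symmetric_kernel_opp sK')
  (neg_list_opp lK) (neg_list_opp lK') m0 d0).
apply: le_trans hsd; rewrite le_eqVlt; apply/orP; left; apply/eqP.
by apply: eq_Rintegral => x _; apply: eq_Rintegral => y _; ring.
Qed.

End EigenvalueLists.

(** * One-dimensional estimates *)

Section Means.
Context (R : realType).
Implicit Types (f g : R -> R).

Local Notation P := (@unif R).
Local Notation I01 := (@unit_interval R).
Local Notation leb := (@lebesgue_measure R).

Lemma measurable_inv : measurable_fun [set: R] (fun x : R => x^-1).
Proof.
(* This form uses only the measurability of real powers, with a nonnegative base; at 0 both sides
   are 0. *)
have -> : (fun x : R => x^-1) = fun x : R => x * ((x ^+ 2) `^ (-1)).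
  apply/funext => x; rewrite powR_inv1 ?sqr_ge0//.
  have [->|x0] := eqVneq x 0; first by rewrite invr0 mul0r.
  by rewrite expr2 invfM mulrA divff// mul1r.
apply: measurable_funM; first exact: measurable_id.
have h1 := @measurable_powR R (-1).
have h2 := @exprn_measurable R setT 2.
exact: (measurableT_comp h1 h2).
Qed.

Lemma measurable_floor_fun : measurable_fun setT (fun x : R => (Num.floor x)%:~R : R).
Proof.
by apply: nondecreasing_measurable => // x y xy; rewrite ler_int le_floor.
Qed.

Lemma measurable_ceil_fun : measurable_fun setT (fun x : R => (Num.ceil x)%:~R : R).
Proof.
by apply: nondecreasing_measurable => // x y xy; rewrite ler_int le_ceil.
Qed.

Lemma le_mean_unit f g : bmeas f -> bmeas g ->
  (forall x, x \in `[0, 1] -> f x <= g x) -> \int[P]_x f x <= \int[P]_x g x.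
Proof.
move=> bf bg fg; rewrite !mean_unif//; apply: le_Rintegral.
- exact: measurable_unit.
- exact: bmeas_integrable_unit.
- exact: bmeas_integrable_unit.
- by move=> x /= /fg.
Qed.

Lemma bmeas_if d (T : measurableType d) (c : T -> bool) (f g : T -> R) :
  measurable_fun setT c -> bmeas f -> bmeas g ->
  bmeas (fun x => if c x then f x else g x).
Proof.
move=> mc [mf [M fM]] [mg [N gN]]; split; first exact: measurable_fun_ifT.
exists (Num.max M N) => x; case: ifPn => _.
  by rewrite (le_trans (fM x))// le_max lexx.
by rewrite (le_trans (gN x))// le_max lexx orbT.
Qed.

Lemma mean_itv_le (b c : R) : b <= c ->
  \int[P]_x (if b <= x <= c then 1 else 0) <= c - b.
Proof.
move=> bc; have mc : measurable_fun setT (fun x : R => b <= x <= c).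
  by apply: measurable_and; exact: measurable_fun_ler.
rewrite mean_unif; last by apply: bmeas_if => //; exact: bmeas_cst.
have -> : \int[leb]_(x in I01) (if b <= x <= c then 1 else 0) =
    fine (leb (`[b, c] `&` I01)).
  rewrite /Rintegral -integral_indic//; first congr fine.
    apply: eq_integral => x _; rewrite indicE.
    have [bxc|bxc] := boolP (b <= x <= c).
      by rewrite mem_set//= in_itv.
    by rewrite memNset//= in_itv/=; apply/negP.
  exact: measurable_unit.
have lebbc : leb `[b, c] = (c - b)%:E.
  rewrite lebesgue_measure_itv/= lte_fin.
  move: bc; rewrite le_eqVlt => /predU1P[->|->]; last by rewrite EFinB.
  by rewrite ltxx subrr.
rewrite -lee_fin -lebbc fineK.
  apply: le_measure; [rewrite inE|rewrite inE|exact: subIsetl]; last exact: measurable_itv.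
  by apply: measurableI; [exact: measurable_itv|exact: measurable_unit].
rewrite ge0_fin_numE//.
apply: (@le_lt_trans _ _ (leb `[b, c])); last by rewrite lebbc ltry.
apply: le_measure; [rewrite inE|rewrite inE|exact: subIsetl]; last exact: measurable_itv.
  by apply: measurableI; [exact: measurable_itv|exact: measurable_unit].
Qed.

Lemma integral_FTC_pos (f F : R -> R) (a b : R) : 0 < a -> a < b ->
  (forall x : R, 0 < x -> is_derive x (1 : R) F (f x)) ->
  (forall x : R, 0 < x -> {for x, continuous f}) ->
  \int[leb]_(x in `[a, b]) f x = F b - F a.
Proof.
move=> a0 ab dF cf.
have pos (x : R) : x \in `[a, b] -> 0 < x.
  by rewrite in_itv/= => /andP[ax _]; exact: lt_le_trans ax.
have cF (x : R) : 0 < x -> {for x, continuous F}.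
  move=> x0; have ? := dF x x0.
  by apply: differentiable_continuous; apply/derivable1_diffP; exact: ex_derive.
rewrite /Rintegral (@continuous_FTC2 _ f F a b ab)//.
- apply: continuous_in_subspaceT => x /set_mem /= /pos; exact: cf.
- split.
  + move=> x; rewrite in_itv/= => /andP[ax _].
    by have ? := dF x (lt_trans a0 ax); exact: ex_derive.
  + by apply: cvg_at_right_filter; exact: cF.
  + by apply: cvg_at_left_filter; apply: cF; exact: lt_trans ab.
- move=> x; rewrite in_itv/= => /andP[ax _].
  by have ? := dF x (lt_trans a0 ax); rewrite derive1E derive_val.
Qed.

Lemma bmeas_inv4 (a : R) : 0 < a ->
  bmeas (fun x : measurableTypeR R => if x <= a then 0 else x^-1 ^+ 4).
Proof.
move=> a0.
split.
  apply: measurable_fun_ifT; [exact: measurable_fun_ler|exact: measurable_cst|].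
  by apply: measurable_funX; exact: measurable_inv.
exists (a^-1 ^+ 4) => x; have [_|ax] := leP x a; first by rewrite normr0 exprn_ge0// invr_ge0 ltW.
have x0 : 0 < x by exact: lt_trans ax.
rewrite ger0_norm ?exprn_ge0 ?invr_ge0 ?(ltW x0)//.
by apply: lerXn2r; rewrite ?nnegrE ?invr_ge0 ?(ltW x0) ?(ltW a0)// lef_pV2 ?posrE// ltW.
Qed.

Lemma mean_inv4_le (a : R) : 0 < a ->
  \int[P]_x (if x <= a then 0 else x^-1 ^+ 4) <= a^-1 ^+ 3 / 3.
Proof.
move=> a0.
have bf := bmeas_inv4 a0.
have [a1|a1] := leP 1 a.
  rewrite (@eq_mean_unit _ _ (fun=> 0))//; last 2 first.
  - exact: bmeas_cst.
  - by move=> x; rewrite in_itv/= => /andP[_ x1]; rewrite (le_trans x1).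
  by rewrite mean_cst divr_ge0// exprn_ge0// invr_ge0 ltW.
have -> : a^-1 ^+ 3 / 3 = a^-1 ^+ 3 / 3 - 3^-1 + 3^-1 by ring.
have E : \int[leb]_(x in `[a, 1]) (x^-1 ^+ 4) = - (1^-1 ^+ 3 / 3) - - (a^-1 ^+ 3 / 3).
  apply: (@integral_FTC_pos _ (fun x => - (x^-1 ^+ 3 / 3))) => // x x0.
    have x_neq0 : x != 0 by rewrite gt_eqF.
    have d3 := is_deriveX 3 (is_deriveV x_neq0 (is_derive_id x (1 : R))).
    have dF := is_deriveZ (- 3^-1) d3.
    have -> : (fun x : R => - (x^-1 ^+ 3 / 3)) =
        (- 3^-1) \*: ((fun y : R => (id y)^-1) ^+ 3).
      by apply/funext => y /=; rewrite exprfctE /GRing.scale/=; ring.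
    apply: is_derive_eq dF _; rewrite /GRing.scale/=; field.
    exact: x_neq0.
  apply: (@continuous_comp _ _ _ (fun y : R => y^-1) (fun y => y ^+ 4)).
    by apply: inv_continuous; rewrite gt_eqF.
  exact: exprn_continuous.
have sub1 : (`]a, 1] `<=` I01)%classic.
  move=> x /=; rewrite !in_itv/= => /andP[ax x1].
  by apply/andP; split=> //; exact: ltW (lt_trans a0 ax).
have ig : leb.-integrable `]a, 1] (EFin \o (fun x : R => x^-1 ^+ 4)).
  have := integrableS (@measurable_unit R) (@measurable_itv _ _) sub1 (bmeas_integrable_unit bf).
  apply: eq_integrable => //= x; rewrite inE/= in_itv/= => /andP[ax _].
  by rewrite leNgt ax.
have -> : \int[P]_x (if x <= a then 0 else x^-1 ^+ 4) = \int[leb]_(x in `[a, 1]) (x^-1 ^+ 4).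
  rewrite mean_unif// -Rintegral_itv_obnd_cbnd//.
  have -> : `]a, 1]%classic = I01 `&` `]a, 1]%classic.
    by rewrite setIidr.
  rewrite Rintegral_mkcondr; apply: eq_Rintegral => x; rewrite inE => /andP[_]; rewrite bnd_simp => x1.
  rewrite patchE; have [xa|ax] := leP x a.
    by rewrite memNset//= in_itv/= ltNge xa.
  by rewrite mem_set//= in_itv/= ax x1.
by rewrite E invr1 expr1n; lra.
Qed.

Lemma mean_le_le (a : R) : 0 <= a ->
  \int[P]_x (if x <= a then 1 else 0) <= a.
Proof.
move=> a0; have mle (b : R) : measurable_fun setT (fun x : R => x <= b).
  exact: measurable_fun_ler.
have mge (b : R) : measurable_fun setT (fun x : R => b <= x).
  exact: measurable_fun_ler.
rewrite -[leRHS]subr0; apply: le_trans (mean_itv_le a0).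
apply: le_mean_unit.
- by apply: bmeas_if => //; exact: bmeas_cst.
- by apply: bmeas_if; [exact: measurable_and|exact: bmeas_cst|exact: bmeas_cst].
- by move=> x; rewrite in_itv/= => /andP[-> _].
Qed.

Lemma bmeas_invsqrt (e : R) : 0 < e ->
  bmeas (fun x : measurableTypeR R => if x < e then 0 else (Num.sqrt x)^-1).
Proof.
move=> e0.
split.
  apply: measurable_fun_ifT; [exact: measurable_fun_ltr|exact: measurable_cst|].
  apply: (measurableT_comp measurable_inv).
  exact: (continuous_measurable_fun (@sqrt_continuous R)).
exists (Num.sqrt e)^-1 => x; have [_|ex] := ltP x e.
  by rewrite normr0 invr_ge0 sqrtr_ge0.
rewrite ger0_norm ?invr_ge0 ?sqrtr_ge0//.
rewrite lef_pV2 ?posrE ?sqrtr_gt0//; last exact: lt_le_trans ex.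
exact: ler_wsqrtr.
Qed.

Lemma mean_invsqrt (e : R) : 0 < e -> e < 1 ->
  \int[P]_x (if x < e then 0 else (Num.sqrt x)^-1) = 2 * (1 - Num.sqrt e).
Proof.
move=> e0 e1.
have bf := bmeas_invsqrt e0.
have E : \int[leb]_(x in `[e, 1]) (Num.sqrt x)^-1 = 2 * Num.sqrt 1 - 2 * Num.sqrt e.
  apply: (@integral_FTC_pos _ (fun x => 2 * Num.sqrt x)) => // x x0.
    have d := is_deriveZ (2 : R) (is_derive1_sqrt x0).
    apply: is_derive_eq d _; rewrite /GRing.scale/=; field.
    by rewrite gt_eqF// sqrtr_gt0.
  apply: (@continuous_comp _ _ _ (@Num.sqrt R) (fun y => y^-1)).
    exact: sqrt_continuous.
  by apply: inv_continuous; rewrite gt_eqF// sqrtr_gt0.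
have sub1 : (`[e, 1] `<=` I01)%classic.
  move=> x /=; rewrite !in_itv/= => /andP[ex x1].
  by apply/andP; split=> //; exact: ltW (lt_le_trans e0 ex).
rewrite mean_unif//; transitivity (\int[leb]_(x in `[e, 1]) (Num.sqrt x)^-1).
  have -> : `[e, 1]%classic = I01 `&` `[e, 1]%classic by rewrite setIidr.
  rewrite Rintegral_mkcondr; apply: eq_Rintegral => x.
  rewrite inE => /andP[_]; rewrite bnd_simp => x1.
  rewrite patchE; have [xe|ex] := ltP x e.
    by rewrite memNset//= in_itv/= leNgt xe.
  by rewrite mem_set//= in_itv/= ex x1.
by rewrite E sqrtr1; ring.
Qed.

End Means.

(** * The cost of rounding one coordinate *)

Section KernelDistance.
Context (R : realType) (N : nat) (N0 : (0 < N)%N).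

Local Notation P := (@unif R).
Local Notation n := (N%:R : R).

Let n0 : 0 < n. Proof. by rewrite ltr0n. Qed.

Definition grid (x : R) : R := (Num.ceil (n * x))%:~R / n.

Lemma le_grid x : x <= grid x.
Proof. by rewrite ler_pdivlMr// mulrC ceil_ge. Qed.

Lemma grid_lt x : grid x < x + n^-1.
Proof.
rewrite ltr_pdivrMr// mulrDl mulVf ?gt_eqF// -ltrBlDr [x * _]mulrC.
by have /andP[+ _] := ceil_itv (n * x); rewrite intrD.
Qed.

Lemma grid_gt0 x : 0 < x -> 0 < grid x.
Proof. by move=> x0; exact: lt_le_trans (le_grid x). Qed.

Lemma measurable_grid : measurable_fun [set: R] grid.
Proof.
apply: measurable_funM; last exact: measurable_cst.
have := measurableT_comp (@measurable_ceil_fun R) (@mulrl_measurable R setT n).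
by [].
Qed.

Definition cross (z s : R) : bool :=
  Num.floor ((s * z)^-1) != Num.floor ((grid s * z)^-1).

(** The optimal cutoff. Cutting at s = r / q^(1/2) gives a row bound of (r + 1/(N r) + 2/(3 N^2
    r^3)) q^(-1/2), and its derivative in r vanishes exactly at r^2 = 2/N. *)
Definition rho : R := Num.sqrt (2 / n).

Lemma rho_gt0 : 0 < rho.
Proof. by rewrite sqrtr_gt0 divr_gt0. Qed.

Lemma rho2 : rho ^+ 2 = 2 / n.
Proof. by rewrite sqr_sqrtr// divr_ge0// ltW. Qed.

Lemma measurable_cross d (T : measurableType d) (f g : T -> R) :
  measurable_fun setT f -> measurable_fun setT g ->
  measurable_fun setT (fun t => cross (f t) (g t)).
Proof.
move=> mf mg.
have -> : (fun t => cross (f t) (g t)) = (fun t =>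
   ~~ ((Num.floor ((g t * f t)^-1))%:~R == (Num.floor ((grid (g t) * f t)^-1))%:~R :> R)).
  by apply/funext => t; rewrite eqr_int.
apply: measurable_neg; apply: measurable_fun_eqr.
  apply: (measurableT_comp (@measurable_floor_fun R)).
  apply: (measurableT_comp (@measurable_inv R)); exact: measurable_funM.
apply: (measurableT_comp (@measurable_floor_fun R)).
apply: (measurableT_comp (@measurable_inv R)); apply: measurable_funM => //.
exact: (measurableT_comp measurable_grid).
Qed.

(* If the two floors differ, an integer k separates the two values, so s lies
   within 1/N to the left of 1/(k z), where k <= 1/(a z). *)
Lemma mean_cross (a z : R) : 0 < a -> 0 < z ->
  \int[P]_s (if s <= a then 0 else if cross z s then 1 else 0) <= (n * (a * z))^-1.
Proof.
move=> a0 z0; pose m := Num.truncn ((a * z)^-1).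
(* [I k] belongs to the integer k + 1. The integer used below is the floor of the larger value,
   which exceeds a nonnegative floor and so is at least 1. *)
pose I k (s : R) : R :=
  if (k.+1%:R * z)^-1 - n^-1 <= s <= (k.+1%:R * z)^-1 then 1 else 0.
have mle (b : R) : measurable_fun setT (fun x : R => x <= b).
  exact: measurable_fun_ler.
have mge (b : R) : measurable_fun setT (fun x : R => b <= x).
  exact: measurable_fun_ler.
have bI k : bmeas (I k).
  by apply: bmeas_if; [exact: measurable_and|exact: bmeas_cst|exact: bmeas_cst].
have meanI k : \int[P]_s I k s <= n^-1.
  apply: (le_trans (mean_itv_le _)); last by rewrite opprB addrCA subrr addr0.
  by rewrite gerBl invr_ge0 ltW.
apply: (@le_trans _ _ (\int[P]_s \sum_(k < m) I k s)); last first.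
  rewrite mean_sum; last by move=> k; exact: bI.
  apply: (@le_trans _ _ (\sum_(k < m) n^-1)); first exact: ler_sum.
  rewrite sumr_const card_ord -[_ *+ m]mulr_natr invfM ler_pM2l ?invr_gt0//.
  have : 0 <= (a * z)^-1 by rewrite invr_ge0 mulr_ge0 ?ltW.
  by move=> h; rewrite -truncn_ge_nat.
apply: le_mean_unit.
- apply: bmeas_if; [exact: mle|exact: bmeas_cst|].
  apply: bmeas_if; [|exact: bmeas_cst|exact: bmeas_cst].
  by apply: measurable_cross.
- exact: bmeas_sum.
move=> s _; have I_ge0 k : 0 <= I k s by rewrite /I; case: ifPn.
have [_|as_] := leP s a; first by apply: sumr_ge0.
have s0 : 0 < s by exact: lt_trans as_.
case: ifPn => [cr|_]; last by apply: sumr_ge0.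
have gs0 := grid_gt0 s0.
have gz0 := mulr_gt0 gs0 z0.
have inv_le : (grid s * z)^-1 <= (s * z)^-1.
  by rewrite lef_pV2 ?posrE ?(mulr_gt0 s0 z0)// ler_pM2r// le_grid.
have fl_lt : Num.floor ((grid s * z)^-1) < Num.floor ((s * z)^-1).
  by rewrite lt_neqAle eq_sym le_floor// andbT; exact: cr.
have fl0 : 0 <= Num.floor ((grid s * z)^-1).
  by rewrite floor_ge0 invr_ge0 ltW.
have [k Ek] : exists k : nat, Num.floor ((s * z)^-1) = k.+1%:Z.
  have := le_lt_trans fl0 fl_lt.
  by case: (Num.floor _) => [[|k]|k]// _; exists k.
have k_le : k.+1%:R <= (s * z)^-1.
  by have /andP[+ _] := floor_itv ((s * z)^-1); rewrite Ek.
have k_gt : (grid s * z)^-1 < k.+1%:R.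
  by have := fl_lt; rewrite Ek floor_lt_int.
have km : (k < m)%N.
  rewrite /m truncn_gt_nat (le_trans k_le)// lef_pV2 ?posrE ?mulr_gt0//.
  by rewrite ler_pM2r// ltW.
rewrite (bigD1 (Ordinal km))//= -[leLHS]addr0; apply: lerD; last by apply: sumr_ge0.
rewrite /I; suff -> : (k.+1%:R * z)^-1 - n^-1 <= s <= (k.+1%:R * z)^-1 by [].
have kz0 : 0 < k.+1%:R * z by rewrite mulr_gt0// ltr0n.
apply/andP; split.
  rewrite lerBlDr (le_trans _ (ltW (grid_lt s)))//.
  rewrite -[grid s]invrK lef_pV2 ?posrE ?invr_gt0//.
  rewrite -ler_pdivrMr// -invfM; exact: ltW.
rewrite -[s]invrK lef_pV2 ?posrE ?invr_gt0//.
by rewrite -ler_pdivlMr// -invfM.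
Qed.

(* In the bound for the difference of the kernels, s is the coordinate being
   rounded, z the other coordinate (already rounded or not) that multiplies it,
   and q <= z its unrounded value. The cutoff at q < 1/N avoids an improper
   integral of q^(-1/2). *)
Definition majorant (s z q : R) : R :=
  if q < n^-1 then 1 else if s <= rho / Num.sqrt q then 1 else
  (if cross z s then 1 else 0) + 2 / n ^+ 2 * (q^-1 ^+ 2 * s^-1 ^+ 4).

Lemma majorant_ge0 s z q : 0 <= majorant s z q.
Proof.
rewrite /majorant; case: ifPn => // _; case: ifPn => // _.
apply: addr_ge0; first by case: ifPn.
rewrite mulr_ge0 ?divr_ge0 ?exprn_ge0 ?(ltW n0)// mulr_ge0 ?sqr_ge0//.
by rewrite exprn_even_ge0.
Qed.

Lemma bmeas_majorant d (T : measurableType d) (s z q : T -> R) :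
  measurable_fun setT s -> measurable_fun setT z -> measurable_fun setT q ->
  bmeas (fun t => majorant (s t) (z t) (q t)).
Proof.
move=> ms mz mq.
have mV (f : T -> R) : measurable_fun setT f -> measurable_fun setT (fun t => (f t)^-1).
  by move=> mf; exact: (measurableT_comp (@measurable_inv R)).
split.
  apply: measurable_fun_ifT; [exact: measurable_fun_ltr|exact: measurable_cst|].
  apply: measurable_fun_ifT; [|exact: measurable_cst|].
    apply: measurable_fun_ler => //; apply: measurable_funM => //; apply: mV.
    apply: (measurableT_comp _ mq).
    exact: (continuous_measurable_fun (@sqrt_continuous R)).
  apply: measurable_funD.
    by apply: measurable_fun_ifT => //; exact: measurable_cross.
  apply: measurable_funM => //.
  by apply: measurable_funM; apply: measurable_funX; exact: mV.
exists (2 + 2 / n ^+ 2 * rho^-1 ^+ 4) => t.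
have c0 : 0 <= 2 / n ^+ 2 by rewrite divr_ge0// exprn_ge0// ltW.
have c1 : 0 <= 2 / n ^+ 2 * rho^-1 ^+ 4.
  by rewrite mulr_ge0// exprn_ge0// invr_ge0 ltW// rho_gt0.
rewrite ger0_norm ?majorant_ge0// /majorant.
case: ifPn => [_|]; first lra.
rewrite -leNgt => qn; case: ifPn => [_|]; first lra.
rewrite -ltNge => as_.
have q0 : 0 < q t by apply: lt_le_trans qn; rewrite invr_gt0.
have sq0 : 0 < Num.sqrt (q t) by rewrite sqrtr_gt0.
have a0 : 0 < rho / Num.sqrt (q t) by rewrite divr_gt0// rho_gt0.
have s0 := lt_trans a0 as_.
apply: lerD; first by case: ifPn => _; lra.
apply: ler_wpM2l => //.
(* Beyond the cutoff q^(1/2) s > rho, so this product is at most rho^(-4). *)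
have -> : (q t)^-1 ^+ 2 * (s t)^-1 ^+ 4 = ((Num.sqrt (q t) * s t)^-1) ^+ 4.
  rewrite -{1}[q t]sqr_sqrtr ?(ltW q0)//; field.
  by rewrite !gt_eqF.
apply: lerXn2r; rewrite ?nnegrE ?invr_ge0 ?mulr_ge0 ?(ltW s0) ?sqrtr_ge0//.
rewrite lef_pV2 ?posrE ?mulr_gt0 ?rho_gt0//.
by rewrite mulrC -ler_pdivrMr// ltW.
Qed.

Lemma mean_majorant (z q : R) : 0 < q -> q <= z ->
  \int[P]_s majorant s z q <=
  if q < n^-1 then 1 else 5 / 3 * rho * (Num.sqrt q)^-1.
Proof.
move=> q0 qz; rewrite /majorant; case: ifPn => _; first by rewrite mean_cst.
have h0 : 0 < Num.sqrt q by rewrite sqrtr_gt0.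
have r0 := rho_gt0.
set h := Num.sqrt q in h0 *.
have qh : q = h ^+ 2 by rewrite sqr_sqrtr// ltW.
pose a := rho / h; have a0 : 0 < a by rewrite divr_gt0.
have z0 : 0 < z by exact: lt_le_trans qz.
pose c := 2 / n ^+ 2 * q^-1 ^+ 2.
have c0 : 0 <= c by rewrite mulr_ge0 ?sqr_ge0// divr_ge0// exprn_ge0// ltW.
have mle : measurable_fun setT (fun x : R => x <= a) by exact: measurable_fun_ler.
have b1 : bmeas (fun s : measurableTypeR R => if s <= a then 1 else 0 : R).
  by apply: bmeas_if => //; exact: bmeas_cst.
have b2 : bmeas (fun s : measurableTypeR R =>
    if s <= a then 0 else if cross z s then 1 else 0 : R).
  apply: bmeas_if; [exact: mle|exact: bmeas_cst|].
  apply: bmeas_if; [|exact: bmeas_cst|exact: bmeas_cst].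
  by apply: measurable_cross.
have b3 : bmeas (fun s : measurableTypeR R => if s <= a then 0 else s^-1 ^+ 4).
  exact: bmeas_inv4.
have -> : (fun s : R => if s <= a then 1 else
    (if cross z s then 1 else 0) + 2 / n ^+ 2 * (q^-1 ^+ 2 * s^-1 ^+ 4)) =
  (fun s => (if s <= a then 1 else 0) +
     (if s <= a then 0 else if cross z s then 1 else 0) +
     c * (if s <= a then 0 else s^-1 ^+ 4)).
  apply/funext => s; case: ifPn => _; first by rewrite mulr0 !addr0.
  by rewrite add0r /c mulrA.
rewrite meanD; [|exact: bmeasD|exact: bmeasZ].
rewrite meanD// meanZ//.
(* With q = h^2 and N = 2/rho^2 the three terms are rho/h, rho/(2h) and rho/(6h), with sum (5/3)
   rho/h. In the crossing term z has been lowered to q. *)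
apply: (@le_trans _ _ (a + (n * (a * q))^-1 + c * (a^-1 ^+ 3 / 3))).
  apply: lerD; last by rewrite ler_wpM2l// mean_inv4_le.
  apply: lerD; first by apply: mean_le_le; exact: ltW.
  apply: (le_trans (mean_cross a0 z0)).
  have az0 := mulr_gt0 a0 z0; have aq0 := mulr_gt0 a0 q0.
  by rewrite lef_pV2 ?posrE ?(mulr_gt0 n0 az0) ?(mulr_gt0 n0 aq0)// ler_pM2l// ler_pM2l.
have nE : n = 2 / rho ^+ 2 by rewrite rho2 invf_div mulrC divfK.
rewrite /a /c qh nE.
have -> : rho / h + (2 / rho ^+ 2 * (rho / h * h ^+ 2))^-1 +
  2 / (2 / rho ^+ 2) ^+ 2 * (h ^+ 2)^-1 ^+ 2 * ((rho / h)^-1 ^+ 3 / 3) =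
  5 / 3 * rho / h by field; rewrite !gt_eqF.
by [].
Qed.

(** The strip q < 1/N costs 1/N. Starting the integral of q^(-1/2) at 1/N saves (10/3) rho N^(-1/2),
    which is more because rho >= N^(-1/2). *)
Lemma mean_row_bound : (1 < N)%N ->
  \int[P]_q (if q < n^-1 then 1 else 5 / 3 * rho * (Num.sqrt q)^-1) <= 10 / 3 * rho.
Proof.
move=> N1; have r0 := rho_gt0.
have e0 : 0 < n^-1 by rewrite invr_gt0.
have e1 : n^-1 < 1 by rewrite invf_lt1// ltr1n.
have mlt : measurable_fun setT (fun x : R => x < n^-1) by exact: measurable_fun_ltr.
have mle : measurable_fun setT (fun x : R => x <= n^-1) by exact: measurable_fun_ler.
have b1 : bmeas (fun x : measurableTypeR R => if x < n^-1 then 1 else 0 : R).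
  by apply: bmeas_if => //; exact: bmeas_cst.
have b2 := bmeas_invsqrt e0.
have -> : (fun q : R => if q < n^-1 then 1 else 5 / 3 * rho * (Num.sqrt q)^-1) =
  (fun q => (if q < n^-1 then 1 else 0) + 5 / 3 * rho * (if q < n^-1 then 0 else (Num.sqrt q)^-1)).
  by apply/funext => q; case: ifPn => _; rewrite ?mulr0 ?addr0 ?add0r.
rewrite meanD//; last exact: bmeasZ.
rewrite meanZ// mean_invsqrt//.
have H : \int[P]_x (if x < n^-1 then 1 else 0) <= n^-1.
  apply: le_trans (mean_le_le (ltW e0)); apply: le_mean => //.
    by apply: bmeas_if => //; exact: bmeas_cst.
  by move=> x; case: ltP => [/ltW ->//|_]; case: ifPn.
set w := Num.sqrt n^-1.
have w0 : 0 < w by rewrite sqrtr_gt0.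
have w2 : n^-1 = w ^+ 2 by rewrite sqr_sqrtr// ltW.
have rw : w <= rho by rewrite /w /rho ler_wsqrtr//; lra.
apply: (le_trans (lerD H (lexx _))).
have := ler_wpM2r (ltW w0) rw; have := mulr_gt0 r0 w0; rewrite w2 expr2; lra.
Qed.

End KernelDistance.

(** * The distance between the kernels *)

Section PointwiseBound.
Context (R : realType).
Implicit Types x y : R.

Lemma frac_part_itv x : 0 <= frac_part x < 1.
Proof.
rewrite /frac_part subr_ge0 ltrBlDl.
have /andP[-> H] := floor_itv x; move: H; rewrite intrD => ->.
by [].
Qed.

Lemma bmeas_frac_part d (T : measurableType d) (g : T -> R) :
  measurable_fun setT g -> bmeas (fun t => frac_part (g t)).
Proof.
move=> mg; split; last first.
  by exists 1 => t; have /andP[h0 h1] := frac_part_itv (g t); rewrite ger0_norm// ltW.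
apply: measurable_funB => //.
exact: (measurableT_comp (@measurable_floor_fun R)).
Qed.

Lemma ker_symmetric : symmetric_kernel (@ker R).
Proof.
split; last by move=> x y; rewrite /ker mulrC.
have mxy : measurable_fun setT (fun z : R * R => z.1 * z.2).
  exact: measurable_funM.
apply: bmeas_if; [exact: measurable_fun_eqr|exact: bmeas_cst|].
apply: bmeasB; first exact: bmeas_cst.
apply: bmeas_frac_part; apply: measurable_funM => //.
exact: (measurableT_comp (@measurable_inv R)).
Qed.

Context (N : nat) (N0 : (0 < N)%N).
Local Notation n := (N%:R : R).
Local Notation grid := (@grid R N).

Let n0 : 0 < n. Proof. by rewrite ltr0n. Qed.

Lemma ker_daggerE x y : ker_dagger N x y =
  if x * y == 0 then 0 else 1 / 2 - frac_part ((grid x * grid y)^-1).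
Proof.
rewrite /ker_dagger; case: ifPn => // _; congr (_ - frac_part _).
rewrite /grid; set a := _%:~R; set b := _%:~R.
rewrite !invfM !invrK; ring.
Qed.

Lemma ker_dagger_symmetric : symmetric_kernel (@ker_dagger R N).
Proof.
split; last by move=> x y; rewrite !ker_daggerE mulrC (mulrC (grid x)).
suff : bmeas (fun z : R * R => if z.1 * z.2 == 0 then 0
    else 1 / 2 - frac_part ((grid z.1 * grid z.2)^-1)).
  by congr bmeas; apply/funext => z; rewrite -ker_daggerE.
have mxy : measurable_fun setT (fun z : R * R => z.1 * z.2).
  exact: measurable_funM.
apply: bmeas_if; [exact: measurable_fun_eqr|exact: bmeas_cst|].
apply: bmeasB; first exact: bmeas_cst.
apply: bmeas_frac_part; apply: (measurableT_comp (@measurable_inv R)).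
apply: measurable_funM.
  exact: (measurableT_comp (@measurable_grid R N) measurable_fst).
exact: (measurableT_comp (@measurable_grid R N) measurable_snd).
Qed.

Lemma inv_grid x : 0 < x -> 0 <= x^-1 - (grid x)^-1 <= n^-1 * x^-1 ^+ 2.
Proof.
move=> x0; have gx := le_grid N0 x; have gx1 := grid_lt N0 x.
have g0 := grid_gt0 N0 x0.
rewrite subr_ge0 lef_pV2 ?posrE// gx /=.
have -> : x^-1 - (grid x)^-1 = (grid x - x) * (x^-1 * (grid x)^-1).
  by field; rewrite !gt_eqF.
apply: ler_pM; [by rewrite subr_ge0|by rewrite mulr_ge0 ?invr_ge0 ?(ltW x0) ?(ltW g0)|lra|].
by rewrite expr2 ler_pM2l ?invr_gt0// lef_pV2 ?posrE.
Qed.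

(** The coordinates are rounded one at a time: from w to v at fixed rounded y, from u to w at fixed
    unrounded x, so the two majorants differ in their [z]. Two fractional parts differ by less than
    1, which settles every case where a majorant is at least 1. Otherwise the squared sum of the two
    increments is at most twice the sum of their squares, whence the 2 in [majorant]. *)
Lemma sqr_ker_sub_le x y : x \in `[0, 1] -> y \in `[0, 1] ->
  (ker x y - ker_dagger N x y) ^+ 2 <=
  majorant N x (grid y) y + majorant N y x x.
Proof.
have [M1 M2] : 0 <= majorant N x (grid y) y /\ 0 <= majorant N y x x.
  by split; exact: majorant_ge0.
rewrite !in_itv/= => /andP[x_ge0 _] /andP[y_ge0 _].
rewrite /ker ker_daggerE.
have [_|xy0] := eqVneq (x * y) 0; first by rewrite subrr expr0n/= addr_ge0.
have x0 : 0 < x by rewrite lt_neqAle x_ge0 andbT eq_sym; apply: contra_neq xy0 => ->; rewrite mul0r.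
have y0 : 0 < y by rewrite lt_neqAle y_ge0 andbT eq_sym; apply: contra_neq xy0 => ->; rewrite mulr0.
have gx0 := grid_gt0 N0 x0; have gy0 := grid_gt0 N0 y0.
set u := 1 / (x * y); set v := (grid x * grid y)^-1.
pose w := (x * grid y)^-1.
have e1 : (1 / 2 - frac_part u - (1 / 2 - frac_part v)) ^+ 2 <= 1.
  have /andP[] := frac_part_itv u; have /andP[] := frac_part_itv v.
  set a := frac_part u; set b := frac_part v => *; nra.
have uE : u = (y * x)^-1 by rewrite /u div1r mulrC.
have wE : w = (grid y * x)^-1 by rewrite /w mulrC.
move: M1 M2; rewrite /majorant.
case: ifPn => [_|_] M1; first by move=> M2; rewrite -[leLHS]addr0; exact: lerD.
move: M1; case: ifPn => [_|_] M1; first by move=> M2; rewrite -[leLHS]addr0; exact: lerD.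
move=> M2; move: M1 M2.
case: (ifPn (x < _)) => [_|_] M1; first by move=> M2; rewrite -[leLHS]add0r; exact: lerD.
case: (ifPn (y <= _)) => [_|_] M2; first by rewrite -[leLHS]add0r; exact: lerD.
have T1 : 0 <= 2 / n ^+ 2 * (y^-1 ^+ 2 * x^-1 ^+ 4).
  by rewrite mulr_ge0 ?divr_ge0 ?exprn_ge0 ?(ltW n0)// mulr_ge0// exprn_ge0// invr_ge0.
have T2 : 0 <= 2 / n ^+ 2 * (x^-1 ^+ 2 * y^-1 ^+ 4).
  by rewrite mulr_ge0 ?divr_ge0 ?exprn_ge0 ?(ltW n0)// mulr_ge0// exprn_ge0// invr_ge0.
move: M1 M2; case: ifPn => [_|c1] M1 M2; first by lra.
move: M2; case: ifPn => [_|c2] M2; first by lra.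
rewrite !add0r.
move: c1 c2; rewrite /cross !negbK -/v -/w -uE -wE => /eqP fwv /eqP fuw.
have -> : 1 / 2 - frac_part u - (1 / 2 - frac_part v) = - ((u - w) + (w - v)).
  by rewrite /frac_part fuw fwv; ring.
have /andP[ix0 ix1] := inv_grid x0; have /andP[iy0 iy1] := inv_grid y0.
have gyV : (grid y)^-1 <= y^-1 by lra.
have wv : 0 <= w - v <= n^-1 * y^-1 * x^-1 ^+ 2.
  have -> : w - v = (grid y)^-1 * (x^-1 - (grid x)^-1) by rewrite /w /v !invfM; ring.
  rewrite mulr_ge0 ?invr_ge0 ?(ltW gy0)//= [n^-1 * _]mulrC -mulrA.
  by apply: ler_pM => //; rewrite invr_ge0 ltW.
have uw : 0 <= u - w <= n^-1 * x^-1 * y^-1 ^+ 2.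
  have -> : u - w = x^-1 * (y^-1 - (grid y)^-1) by rewrite /u /w div1r !invfM; ring.
  rewrite mulr_ge0 ?invr_ge0 ?(ltW x0)//= [n^-1 * _]mulrC -mulrA.
  by apply: ler_pM => //; rewrite invr_ge0 ltW.
have -> : 2 / n ^+ 2 * (y^-1 ^+ 2 * x^-1 ^+ 4) = 2 * (n^-1 * y^-1 * x^-1 ^+ 2) ^+ 2.
  by rewrite !expr2; field; rewrite !gt_eqF.
have -> : 2 / n ^+ 2 * (x^-1 ^+ 2 * y^-1 ^+ 4) = 2 * (n^-1 * x^-1 * y^-1 ^+ 2) ^+ 2.
  by rewrite !expr2; field; rewrite !gt_eqF.
move: wv uw; set p := w - v; set q := u - w.
set b1 := n^-1 * _ * _; set b2 := n^-1 * _ * _.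
move=> /andP[p0 pb] /andP[q0 qb].
have := sqr_ge0 (q - p).
have : p ^+ 2 <= b1 ^+ 2 by apply: lerXn2r; rewrite ?nnegrE//; exact: le_trans pb.
have : q ^+ 2 <= b2 ^+ 2 by apply: lerXn2r; rewrite ?nnegrE//; exact: le_trans qb.
by clearbody p q b1 b2; lra.
Qed.

Lemma hs2_ker_sub_le : (1 < N)%N ->
  hs2 (@unif R) (fun x y => ker x y - ker_dagger N x y) <= 20 / 3 * rho R N.
Proof.
move=> N1; pose P := @unif R.
have [bK _] := ker_symmetric; have [bK' _] := ker_dagger_symmetric.
have bA : bkernel (fun x y : measurableTypeR R => majorant N x (grid y) y).
  apply: (bmeas_majorant N0) => //.
  exact: (measurableT_comp (@measurable_grid R N) measurable_snd).
have bB : bkernel (fun x y : measurableTypeR R => majorant N y x x).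
  exact: (bmeas_majorant N0).
have bD : bkernel (fun x y : measurableTypeR R => ker x y - ker_dagger N x y).
  exact: bmeasB.
have bAm : bmeas (fun x : measurableTypeR R => \int[P]_y majorant N x (grid y) y).
  exact: (bmeas_mean P bA).
have bBm : bmeas (fun x : measurableTypeR R => \int[P]_y majorant N y x x).
  exact: (bmeas_mean P bB).
have brow : bmeas (fun q : measurableTypeR R => if q < n^-1 then 1
    else 5 / 3 * rho R N * (Num.sqrt q)^-1).
  have n1 : 0 < n^-1 by rewrite invr_gt0.
  have mlt : measurable_fun setT (fun x : R => x < n^-1) by exact: measurable_fun_ltr.
  have := bmeas_if mlt (bmeas_cst _ 1) (bmeasZ (5 / 3 * rho R N) (bmeas_invsqrt n1)).
  congr bmeas; apply/funext => q; by case: (q < n^-1).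
have row_le (F : R -> R) : bmeas F ->
    (forall q, q \in `[0, 1] -> F q <= if q < n^-1 then 1
       else 5 / 3 * rho R N * (Num.sqrt q)^-1) ->
    \int[P]_q F q <= 10 / 3 * rho R N.
  move=> bF FH; apply: (le_trans _ (mean_row_bound R N0 N1)).
  exact: le_mean_unit.
apply: (@le_trans _ _ (\int[P]_x (\int[P]_y majorant N x (grid y) y
    + \int[P]_y majorant N y x x))).
  apply: le_mean_unit; [exact: (bmeas_hs P bD)|exact: bmeasD|].
  move=> x x01; rewrite -meanD; [|exact: bmeas_row x bA|exact: bmeas_row x bB].
  have bDx := bmeas_row x bD.
  apply: le_mean_unit.
  - exact: bmeasM.
  - by apply: bmeasD; [exact: bmeas_row x bA|exact: bmeas_row x bB].
  - by move=> y y01; rewrite -expr2; exact: sqr_ker_sub_le.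
(* Each majorant must be averaged first over the coordinate being rounded: [x] for the first, hence
   the swap, and [y] for the second. *)
rewrite meanD// mean_swap//.
have -> : 20 / 3 * rho R N = 10 / 3 * rho R N + 10 / 3 * rho R N by field.
have n1 : 0 < n^-1 by rewrite invr_gt0.
apply: lerD; apply: row_le => //.
- apply: (@bmeas_mean _ _ _ P _ _ (fun y x => majorant N x (grid y) y)).
  exact: bmeas_tr bA.
- move=> q; rewrite in_itv/= => /andP[q_ge0 _].
  have [q0|q0] := ltP 0 q; first by apply: mean_majorant => //; exact: le_grid.
  rewrite /majorant (le_lt_trans q0 n1) mean_cst; exact: lexx.
- move=> q; rewrite in_itv/= => /andP[q_ge0 _].
  have [q0|q0] := ltP 0 q; first by apply: mean_majorant.
  rewrite /majorant (le_lt_trans q0 n1) mean_cst; exact: lexx.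
Qed.

End PointwiseBound.

(** * Numerical bounds *)

Section Numerics.
Context (R : realType).

Lemma ln_ge_inv (x : R) : 0 < x -> 1 - x^-1 <= ln x.
Proof.
move=> x0; have : ln (1 + (x^-1 - 1)) <= x^-1 - 1.
  by apply: le_ln1Dx; rewrite ltrBrDl subrr invr_gt0.
by rewrite addrC subrK lnV// => H; lra.
Qed.

(** Each factor (k+1)/k of the telescoping product has logarithm at least 1/(k+1), and 1/5 + 1/6 +
    1/7 + 1/8 = 0.634... *)
Lemma ln2_ge : 63 / 100 <= ln (2 : R).
Proof.
have -> : (2 : R) = 5 / 4 * (6 / 5) * (7 / 6) * (8 / 7) by field.
set a := 5 / 4; set b := 6 / 5; set c := 7 / 6; set d := 8 / 7.
have a0 : 0 < a by rewrite /a; lra.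
have b0 : 0 < b by rewrite /b; lra.
have c0 : 0 < c by rewrite /c; lra.
have d0 : 0 < d by rewrite /d; lra.
rewrite lnM ?posrE ?(mulr_gt0 (mulr_gt0 a0 b0) c0)//.
rewrite lnM ?posrE ?(mulr_gt0 a0 b0)// lnM ?posrE//.
have := ln_ge_inv a0; have := ln_ge_inv b0.
have := ln_ge_inv c0; have := ln_ge_inv d0.
have -> : a^-1 = 4 / 5 by rewrite /a; field.
have -> : b^-1 = 5 / 6 by rewrite /b; field.
have -> : c^-1 = 6 / 7 by rewrite /c; field.
have -> : d^-1 = 7 / 8 by rewrite /d; field.
lra.
Qed.

(* Here q stands for (ln N)^(1/2), and 9.43 exceeds 20 sqrt 2 / 3 = 9.428... *)
Lemma sqrt_ln_bound (q : R) : 1 <= q ->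
  943 / 100 < 2 * q + 4 / 9 + (2 * ln q + 9) / q.
Proof.
move=> q1; have q0 : 0 < q by lra.
(* The logarithm is estimated around 2, near which the resulting lower bound is tightest. With ln 2
   >= 0.63 the numerator 2 ln q + 9 is at least 12.26 - 4/q. *)
have lnq : ln 2 + 1 - 2 / q <= ln q.
  have -> : q = 2 * (q / 2) by field.
  have h0 : 0 < q / 2 by rewrite divr_gt0.
  rewrite [leRHS]lnM ?posrE//.
  have := ln_ge_inv h0; rewrite invf_div.
  have -> : 2 / (2 * (q / 2)) = 2 / q by field; rewrite gt_eqF.
  lra.
have ln2 := ln2_ge.
apply: (@lt_le_trans _ _ (2 * q + 4 / 9 + (1226 / 100 - 4 / q) / q)).
  rewrite -subr_gt0.
  have -> : 2 * q + 4 / 9 + (1226 / 100 - 4 / q) / q - 943 / 100 =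
     (2 * q ^+ 3 - (943 / 100 - 4 / 9) * q ^+ 2 + 1226 / 100 * q - 4) / q ^+ 2.
    by field; rewrite gt_eqF.
  apply: divr_gt0; last exact: exprn_gt0.
  (* The cubic has its local minimum close to 97/50. It equals twice the product in [h3] plus a
     quadratic, and that quadratic is a nonnegative combination of the squares in [h1] and [h2] plus
     a positive constant. *)
  have h1 : 0 <= (q - 97 / 50) ^+ 2 by exact: sqr_ge0.
  have h2 : 0 <= (q - 2) ^+ 2 by exact: sqr_ge0.
  have h3 : 0 <= (q - 97 / 50) ^+ 2 * (q - 1) by rewrite mulr_ge0// subr_ge0.
  clear lnq ln2; lra.
rewrite lerD2l ler_pM2r ?invr_gt0//.
have -> : 4 / q = 2 * (2 / q) by field; rewrite gt_eqF.
lra.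
Qed.

End Numerics.

Theorem theorem2 (R : realType) (m N : nat) (hm : (1 <= m)%N) (hN : (25 <= N)%N)
    (s : bool)
    (p : option nat) (lam : nat -> R)
    (hlam : signed_eigenvalue_list (@ker R) s p lam)
    (pN : option nat) (lamN : nat -> R)
    (hlamN : signed_eigenvalue_list (@ker_dagger R N) s pN lamN) :
  `| nu p lam m - nu pN lamN m | <
    (2 * Num.sqrt (ln N%:R)
     + (1 + 1 / Num.sqrt N%:R) ^+ 8
       * (4 / 9 + 23 / 30 * (N%:R `^ (- (1 / 6))))
     + (ln (ln N%:R) + 9) / Num.sqrt (ln N%:R)) `^ (1 / 2)
    * N%:R `^ (- (1 / 4)).
Proof.
have N0 : (0 < N)%N by exact: leq_trans hN.
have N1 : (1 < N)%N by exact: leq_trans hN.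
have n0 : 0 < (N%:R : R) by rewrite ltr0n.
have hs := hs2_ker_sub_le R N0 N1.
have r0 := rho_gt0 R N0.
pose h := 20 / 3 * rho R N.
have h0 : 0 <= h by rewrite mulr_ge0 ?divr_ge0// ltW.
have hs' : hs2 (@unif R) (fun x y => ker x y - ker_dagger N x y) <= Num.sqrt h ^+ 2.
  by rewrite sqr_sqrtr.
have step := nu_perturbation (ker_symmetric R)
  (ker_dagger_symmetric R N) hlam hlamN hm (sqrtr_ge0 h) hs'.
apply: (le_lt_trans step).
set B := _ + _ + _.
(* Since N >= 25, ln N >= 2 ln 5 >= 2 (1 - 1/5) = 8/5. *)
have lnN : 1 <= ln (N%:R : R).
  have le25 : 5 * 5 <= (N%:R : R) by rewrite -natrM ler_nat.
  have gt25 : 0 < (5 * 5 : R) by rewrite mulr_gt0.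
  have : ln (5 * 5 : R) <= ln (N%:R : R) by rewrite ler_ln ?posrE.
  rewrite lnM ?posrE//; have : 1 - 5^-1 <= ln (5 : R) by exact: ln_ge_inv.
  lra.
pose q := Num.sqrt (ln (N%:R : R)).
have q1 : 1 <= q by rewrite -[leLHS]sqrtr1 ler_wsqrtr.
have q0 : 0 < q by lra.
have lnE : ln (N%:R : R) = q ^+ 2 by rewrite sqr_sqrtr//; lra.
(* Both factors are bounded below by their limits for large N, 1 and 4/9. *)
have mid : 4 / 9 <= (1 + 1 / Num.sqrt (N%:R : R)) ^+ 8
       * (4 / 9 + 23 / 30 * (N%:R `^ (- (1 / 6)))).
  have c0 : 0 <= (N%:R : R) `^ (- (1 / 6)) by exact: powR_ge0.
  have c1 : 1 <= (1 + 1 / Num.sqrt (N%:R : R)) ^+ 8.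
    by apply: exprn_ege1; rewrite lerDl divr_ge0// sqrtr_ge0.
  rewrite -[leLHS]mul1r; apply: ler_pM => //; lra.
have B1 : 943 / 100 < B.
  apply: (lt_le_trans (sqrt_ln_bound q1)).
  rewrite /B -/q lnE lnXn// -[ln q *+ 2]mulr_natl lerD2r lerD2l.
  exact: mid.
have B0 : 0 < B by lra.
pose w := (N%:R : R) `^ (- (1 / 4)).
have w0 : 0 < w by exact: powR_gt0.
have w2 : w ^+ 2 = Num.sqrt (N%:R^-1).
  rewrite -powR_mulrn ?ltW// -powRrM -powR12_sqrt ?invr_ge0 ?ltW//.
  rewrite -[N%:R^-1]powR_inv1 ?ltW// -powRrM; congr (_ `^ _).
  by field.
rewrite -/w.
have -> : B `^ (1 / 2) = Num.sqrt B by rewrite div1r powR12_sqrt// ltW.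
have sB : 0 <= Num.sqrt B by exact: sqrtr_ge0.
(* After squaring, both sides carry the factor N^(-1/2), and (20/3) 2^(1/2) < B remains. *)
rewrite -ltr_sqr ?nnegrE ?sqrtr_ge0 ?mulr_ge0 ?(ltW w0)//.
rewrite exprMn !sqr_sqrtr ?(ltW B0)// w2 /h /rho sqrtrM//.
have sN : 0 < Num.sqrt (N%:R^-1 : R) by rewrite sqrtr_gt0 invr_gt0.
rewrite mulrA ltr_pM2r//.
(* A continued fraction convergent from above; (20/3)(99/70) = 66/7 = 9.4285... is still below
   9.43. *)
have s2 : Num.sqrt (2 : R) < 99 / 70.
  rewrite -ltr_sqr ?nnegrE ?sqrtr_ge0//.
  by rewrite sqr_sqrtr//; lra.
lra.
Qed.
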